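(* Let $\sigma_1,\sigma_2\in L_2[0,1]$, and let $D(x,\mu)$ be the solution of \[ D'(x)+J(x)D(x)=A_\mu D(x),\quad x\in[0,1],\qquad D(0)=I. \] For every $d>0$ there exist constants $a_j=a_j(d,\|\sigma_1\|_{L_2},\|\sigma_2\|_{L_2})$, $j=0,1,2$, such that for all $x\in[0,1]$ and $\mu\in P_d$, \[ D(x,\mu)=e^{xA_\mu}+R(x,\mu), \] where \[ \|R(x,\mu)\|_{M(C[0,1])}\le a_0,\qquad \|R(x,\mu)\|_{M(\mathbb{C})}\le a_1\big(\gamma(\mu)+\gamma_0(x,\mu)\big),\quad x\in[0,1]. \] Moreover, \[ D(x,\mu)=e^{xA_\mu}+D_0(x,\mu)+R_0(x,\mu), \] where \[ D_0(x,\mu):=-\int_0^x e^{(x-2t)A_\mu}J(t)\,dt \] and \[ \|R_0(x,\mu)\|_{M(C[0,1])}\le a_2\big(\gamma(\mu)+\gamma_1(\mu)\big). \] Here the norm $\|\cdot\|_{M(C[0,1])}$ is taken with respect to $x\in[0,1]$.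
   Context: $\sigma_1,\sigma_2$ are complex-valued functions on $[0,1]$, $P_d:=\{\mu\in\mathbb{C}:|\mathrm{Im}\,\mu|\le d\}$, and \[ J(x)=\begin{bmatrix}0&\sigma_1(x)\\ \sigma_2(x)&0\end{bmatrix},\quad J_0=\begin{bmatrix}1&0\\0&-1\end{bmatrix},\quad A_\mu=i\mu J_0,\quad I=\begin{bmatrix}1&0\\0&1\end{bmatrix}. \] Solutions have absolutely continuous entries and satisfy the equation a.e. For a Banach space $X$, $M(X)$ is the space of $2\times2$ matrices with entries in $X$ and norm $\|F\|_{M(X)}=\sum_{k,j=1}^2\|F_{kj}\|_X$; $L_p=L_p[0,1]$. With $\sigma_0(x)=|\sigma_1(x)|+|\sigma_2(x)|$, \[ \gamma(\mu)=\sum_{j=1}^2\Big(\Big\|\int_0^xe^{-2i\mu t}\sigma_j(t)dt\Big\|_{L_2}+\Big\|\int_0^xe^{2i\mu t}\sigma_j(t)dt\Big\|_{L_2}\Big) \] ($L_2$-norms in $x\in[0,1]$), \[ \gamma_0(x,\mu)=\sum_{j=1}^2\Big(\Big|\int_0^xe^{-2i\mu t}\sigma_j(t)dt\Big|+\Big|\int_0^xe^{2i\mu t}\sigma_j(t)dt\Big|\Big),\qquad \gamma_1(\mu)=\int_0^1\sigma_0(s)\gamma_0^2(s,\mu)\,ds. \] *)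

(* Defs.v *)
From HB Require Import structures.
From mathcomp Require Import all_boot all_order all_algebra.
From mathcomp Require Import all_classical all_reals all_analysis.
From mathcomp Require Import complex.

Set Implicit Arguments.
Unset Strict Implicit.
Unset Printing Implicit Defensive.

Import Order.TTheory GRing.Theory Num.Theory.
Import numFieldNormedType.Exports.

Local Open Scope classical_set_scope.
Local Open Scope ring_scope.
Local Open Scope complex_scope.

(* Functions on [0,1] are total functions on R whose values outside [0,1] are
   never used. No topology or measurable structure is inferred by the library
   on R[i], so limits, derivatives and integrals of complex-valued functions
   are taken on real and imaginary parts. *)

Section Defs.
Variable R : realType.
Local Notation C := R[i].
Local Notation M2 := 'M[R[i]]_2.
Local Notation leb := (@lebesgue_measure R).
Local Notation I01 := (`[(0 : R), (1 : R)]%classic : set R).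
Implicit Types (f : R -> C) (F : R -> M2) (x : R) (mu : C).

Definition cmod (z : C) : R := Normc.normc z.

Definition cexp (z : C) : C :=
  (expR (complex.Re z))%:C * (cos (complex.Im z) +i* sin (complex.Im z)).

(* Entrywise limit of the partial sums of the power series. *)
Definition mexp (A : M2) : M2 :=
  let S (n : nat) : M2 := \sum_(m < n) (m`!%:R)^-1 *: A ^+ m in
  \matrix_(k, j) (limn (fun n => complex.Re (S n k j))
                  +i* limn (fun n => complex.Im (S n k j))).

Definition cint x f : C :=
  (\int[leb]_(t in `[0, x]) complex.Re (f t))%R
  +i* (\int[leb]_(t in `[0, x]) complex.Im (f t))%R.

Definition mint x F : M2 := \matrix_(k, j) cint x (fun t => F t k j).

Definition eL2norm f : \bar R :=
  ('N[leb]_2%:E[(fun x => (cmod (f x))%:E) \_ I01])%E.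

Definition L2norm f : R := fine (eL2norm f).

Definition inL2 f : Prop :=
  [/\ measurable_fun I01 (fun x => complex.Re (f x)),
      measurable_fun I01 (fun x => complex.Im (f x))
    & (eL2norm f < +oo)%E].

Definition cderive_at f x (l : C) : Prop :=
  is_derive x (1 : R) (fun t => complex.Re (f t)) (complex.Re l) /\
  is_derive x (1 : R) (fun t => complex.Im (f t)) (complex.Im l).

Definition abs_cont f : Prop :=
  forall e : R, 0 < e -> exists2 del : R, 0 < del &
    forall (n : nat) (u v : 'I_n -> R),
      (forall i, 0 <= u i /\ u i <= v i /\ v i <= 1) ->
      trivIset [set: 'I_n] (fun i => `]u i, v i[%classic) ->
      \sum_(i < n) (v i - u i) < del ->
      \sum_(i < n) cmod (f (v i) - f (u i)) < e.

Definition Mnorm (B : M2) : R := \sum_k \sum_j cmod (B k j).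

Definition inMC F : Prop := forall k j,
  {within I01, continuous (fun x => complex.Re (F x k j))} /\
  {within I01, continuous (fun x => complex.Im (F x k j))}.

(* Extended-real valued, so that an upper bound cannot hold through the
   default value of the supremum of an unbounded set. *)
Definition MCnorm F : \bar R :=
  (\sum_k \sum_j
     ereal_sup [set (cmod (F x k j))%:E | x in I01])%E.

Definition strip (d : R) : set C := [set mu | `|complex.Im mu| <= d].

Definition mx22 (a b c e : C) : M2 :=
  \matrix_(k, j) if k == 0 then (if j == 0 then a else b)
                 else (if j == 0 then c else e).

Definition Jmx (s1 s2 : R -> C) x : M2 := mx22 0 (s1 x) (s2 x) 0.

Definition J0 : M2 := mx22 1 0 0 (-1).

Definition Amx mu : M2 := ((0 +i* 1) * mu) *: J0.

Definition is_solution (s1 s2 : R -> C) mu F : Prop :=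
  [/\ forall k j, abs_cont (fun x => F x k j),
      {ae leb, forall x, x \in `[0, 1] -> exists F' : M2,
         (forall k j, cderive_at (fun t => F t k j) x (F' k j)) /\
         F' + Jmx s1 s2 x *m F x = Amx mu *m F x}
    & F 0 = 1%:M].

Definition expint (c : R) mu f x : C :=
  cint x (fun t => cexp ((0 +i* 1) * (c * t)%:C * mu) * f t).

Definition gamma (s1 s2 : R -> C) mu : R :=
  (L2norm (expint (-2) mu s1) + L2norm (expint 2 mu s1)) +
  (L2norm (expint (-2) mu s2) + L2norm (expint 2 mu s2)).

Definition gamma0 (s1 s2 : R -> C) x mu : R :=
  (cmod (expint (-2) mu s1 x) + cmod (expint 2 mu s1 x)) +
  (cmod (expint (-2) mu s2 x) + cmod (expint 2 mu s2 x)).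

Definition sigma0 (s1 s2 : R -> C) x : R := cmod (s1 x) + cmod (s2 x).

Definition gamma1 (s1 s2 : R -> C) mu : R :=
  (\int[leb]_(s in I01) (sigma0 s1 s2 s * gamma0 s1 s2 s mu ^+ 2))%R.

Definition D0 (s1 s2 : R -> C) x mu : M2 :=
  - mint x (fun t => mexp ((x - 2 * t)%:C *: Amx mu) *m Jmx s1 s2 t).

End Defs.

(* Main.v *)
Require Import Defs.
From HB Require Import structures.
From mathcomp Require Import all_boot all_order all_algebra.
From mathcomp Require Import all_classical all_reals all_analysis.
From mathcomp Require Import measurable_realfun.
From mathcomp Require Import complex ring lra.
Import Order.TTheory GRing.Theory Num.Theory.
Import numFieldNormedType.Exports.
Local Open Scope classical_set_scope.
Local Open Scope ring_scope.
Local Open Scope complex_scope.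
Set Implicit Arguments.
Unset Strict Implicit.
Unset Printing Implicit Defensive.

(** Factoring out the exponentials turns each column of the matrix equation
    into a scalar system without diagonal part.  For the first column put
    p = exp(- i mu x) D_11 and q = exp(i mu x) D_21; then
      p' = - e1 q,   q' = - e2 p,   p(0) = 1,   q(0) = 0
    almost everywhere, with e1 = exp(- 2 i mu x) sigma_1 and
    e2 = exp(2 i mu x) sigma_2.  The second column has the same form, with mu
    replaced by - mu and sigma_1, sigma_2 exchanged.  In the strip |Im mu| <= d
    all the exponentials involved are bounded in terms of d, so the L_2 norms
    of e1 and e2 are at most a multiple m of the sum of those of sigma_1 and
    sigma_2.

    Write E for the primitive of e2 that vanishes at 0.  Its modulus at x is a
    summand of gamma_0(x, mu) and its L_2 norm is a summand of gamma(mu).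
    - A weighted maximum of |p| + |q|, with weight exp(- lam x) and lam large,
      is at most 2 by the Cauchy-Schwarz inequality, which bounds |p| + |q| by a
      constant B ([system_bounded]).
    - q + E p has derivative E p' = - E e1 q, whence
      |q| <= B |E| + m B ||E|| ([system_q_bound]).
    - p' = - e1 q then gives |p - 1| <= C ||E|| ([system_p_bound]), and
      (q + E)' = - e2 (p - 1) gives |q + E| <= C ||E|| ([system_qE_bound]).
    Since exp((x - 2t) A) is diagonal, the first column of D_0 is
    (0, - exp(- i mu x) E), and multiplying by exp(i mu x) and exp(- i mu x)
    turns these estimates into the bounds on R and R_0.  For coefficients in
    L_2 the remainder R_0 is thus bounded by a multiple of gamma alone, and
    gamma_1 enters only through gamma_1 >= 0.

    Each estimate compares an increment of a function f with the integral of a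
    bound h for |f'|.  The functions are only absolutely continuous with an
    almost everywhere derivative, and the comparison is
    [abs_cont_le_integral]: a real induction over [0,1] in which the points
    without derivative are covered by an open set of small measure, where
    absolute continuity makes the total increment small, while at every other
    point the derivatives of f and of the integral of h are compared. *)

(** * Complex modulus and derivatives *)

Section ComplexModulus.
Variable R : realType.
Implicit Types z w : R[i].

Lemma cReD z w : complex.Re (z + w) = complex.Re z + complex.Re w.
Proof. by case: z w => [a b] [c e]. Qed.
Lemma cImD z w : complex.Im (z + w) = complex.Im z + complex.Im w.
Proof. by case: z w => [a b] [c e]. Qed.
Lemma cReN z : complex.Re (- z) = - complex.Re z.
Proof. by case: z. Qed.
Lemma cImN z : complex.Im (- z) = - complex.Im z.
Proof. by case: z. Qed.
Lemma cReM z w :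
  complex.Re (z * w) = complex.Re z * complex.Re w - complex.Im z * complex.Im w.
Proof. by case: z w => [a b] [c e]. Qed.
Lemma cImM z w :
  complex.Im (z * w) = complex.Re z * complex.Im w + complex.Im z * complex.Re w.
Proof. by case: z w => [a b] [c e]. Qed.

Lemma complex_ext z w :
  complex.Re z = complex.Re w -> complex.Im z = complex.Im w -> z = w.
Proof. by case: z w => [a b] [c e] /= -> ->. Qed.

Lemma cmodM z w : cmod (z * w) = cmod z * cmod w.
Proof. exact: Normc.normcM. Qed.
Lemma cmodN z : cmod (- z) = cmod z.
Proof. exact: normcN. Qed.
Lemma cmodD z w : cmod (z + w) <= cmod z + cmod w.
Proof. exact: le_normcD. Qed.
Lemma cmodB z w : cmod (z - w) <= cmod z + cmod w.
Proof. by rewrite (le_trans (cmodD _ _))// cmodN. Qed.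
Lemma cmod0 : cmod (0 : R[i]) = 0.
Proof. exact: Normc.normc0. Qed.
Lemma cmod1 : cmod (1 : R[i]) = 1.
Proof. exact: Normc.normc1. Qed.
Lemma cmod_ge0 z : 0 <= cmod z.
Proof. by case: z => a b; exact: sqrtr_ge0. Qed.

Lemma cmod_real (r : R) : cmod r%:C = `|r|.
Proof. by rewrite /cmod /= expr0n /= addr0 sqrtr_sqr. Qed.

Lemma normr_Re_le z : `|complex.Re z| <= cmod z.
Proof.
by case: z => a b /=; rewrite -sqrtr_sqr ler_wsqrtr// lerDl sqr_ge0.
Qed.
Lemma normr_Im_le z : `|complex.Im z| <= cmod z.
Proof.
by case: z => a b /=; rewrite -sqrtr_sqr ler_wsqrtr// lerDr sqr_ge0.
Qed.
Lemma cmod_le_ReIm z : cmod z <= `|complex.Re z| + `|complex.Im z|.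
Proof.
case: z => a b /=; rewrite -[leRHS]ger0_norm ?addr_ge0// -sqrtr_sqr.
rewrite ler_wsqrtr// sqrrD !real_normK ?num_real// lerD2r lerDl.
by rewrite mulrn_wge0// mulr_ge0.
Qed.

Lemma cmodB_sym z w : cmod (z - w) = cmod (w - z).
Proof. by rewrite -cmodN opprB. Qed.

End ComplexModulus.

Section ComplexDerivative.
Variable R : realType.
Implicit Types (f g : R -> R[i]) (x : R) (z w l m : R[i]).

Lemma cderive_cst z x : cderive_at (fun=> z) x 0.
Proof. by split; exact: is_derive_cst. Qed.

Lemma cderiveD f g x l m : cderive_at f x l -> cderive_at g x m ->
  cderive_at (fun t => f t + g t) x (l + m).
Proof.
move=> [f1 f2] [g1 g2]; split; rewrite ?cReD ?cImD.
  rewrite (_ : (fun t => _) = (fun t => complex.Re (f t)) \+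
      (fun t => complex.Re (g t))); last first.
    by apply/funext => t /=; rewrite cReD.
  exact: is_deriveD.
rewrite (_ : (fun t => _) = (fun t => complex.Im (f t)) \+
    (fun t => complex.Im (g t))); last first.
  by apply/funext => t /=; rewrite cImD.
exact: is_deriveD.
Qed.

Lemma cderiveM f g x l m : cderive_at f x l -> cderive_at g x m ->
  cderive_at (fun t => f t * g t) x (l * g x + f x * m).
Proof.
move=> [f1 f2] [g1 g2]; split.
  rewrite (_ : (fun t => _) = ((fun t => complex.Re (f t)) *
      (fun t => complex.Re (g t)))
     - ((fun t => complex.Im (f t)) * (fun t => complex.Im (g t)))); last first.
    by apply/funext => t /=; rewrite cReM.
  apply: is_derive_eq.
  by rewrite /GRing.scale/= !cReD !cReM; ring.
rewrite (_ : (fun t => _) = ((fun t => complex.Re (f t)) * (fun t => complex.Im (g t)))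
     + ((fun t => complex.Im (f t)) * (fun t => complex.Re (g t)))); last first.
  by apply/funext => t /=; rewrite cImM.
apply: is_derive_eq.
by rewrite /GRing.scale/= !cImD !cImM; ring.
Qed.

Lemma cderiveZ f x l z : cderive_at f x l -> cderive_at (fun t => z * f t) x (z * l).
Proof.
move=> fl; have := cderiveM (cderive_cst z x) fl.
by rewrite mul0r add0r.
Qed.

Lemma cderive_sum (n : nat) (F : 'I_n -> R -> R[i]) (l : 'I_n -> R[i]) x :
  (forall i, cderive_at (F i) x (l i)) ->
  cderive_at (fun t => \sum_i F i t) x (\sum_i l i).
Proof.
elim: n F l => [|n IH] F l Fl.
  rewrite big_ord0 (_ : (fun t => _) = fun=> 0); first exact: cderive_cst.
  by apply/funext => t; rewrite big_ord0.
rewrite big_ord_recl (_ : (fun t => _) = fun t => F ord0 t + \sum_(i < n) F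
    (lift ord0 i) t).
  by apply: cderiveD => //; exact: IH.
by apply/funext => t; rewrite big_ord_recl.
Qed.

Lemma cderive_real x : cderive_at (fun t : R => t%:C) x 1.
Proof. by split; [exact: is_derive_id|exact: is_derive_cst]. Qed.

Lemma cderive_lin z x : cderive_at (fun t : R => t%:C * z) x z.
Proof.
have := cderiveZ z (cderive_real x); rewrite mulr1; congr cderive_at.
by apply/funext => t; rewrite mulrC.
Qed.

Lemma cderive_pow z x n :
  cderive_at (fun t : R => (t%:C * z) ^+ n) x (n%:R * z * (x%:C * z) ^+ n.-1).
Proof.
elim: n => [|n IH]; first by rewrite !mul0r; exact: cderive_cst.
rewrite (_ : (fun t => _) = fun t : R => (t%:C * z) * (t%:C * z) ^+ n); last first.
  by apply/funext => t; rewrite exprS.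
have := cderiveM (cderive_lin z x) IH; congr cderive_at.
case: n {IH} => [|n] /=; first by rewrite !expr0; ring.
by rewrite exprS; ring.
Qed.

Lemma cderive_cexp f x l : cderive_at f x l ->
  cderive_at (fun t => cexp (f t)) x (l * cexp (f x)).
Proof.
move=> [f1 f2].
have de : is_derive x (1:R) (fun t => expR (complex.Re (f t)))
    (expR (complex.Re (f x)) * complex.Re l).
  by have h := @is_derive1_comp R expR (fun t => complex.Re (f t)) x _ _
      (is_derive_expR _) f1; apply: (is_derive_eq h); rewrite mulrC.
have dc : is_derive x (1:R) (fun t => cos (complex.Im (f t)))
    (- sin (complex.Im (f x)) * complex.Im l).
  by have h := @is_derive1_comp R cos (fun t => complex.Im (f t)) x _ _
      (is_derive_cos _) f2; apply: (is_derive_eq h); rewrite mulrC.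
have ds : is_derive x (1:R) (fun t => sin (complex.Im (f t)))
    (cos (complex.Im (f x)) * complex.Im l).
  by have h := @is_derive1_comp R sin (fun t => complex.Im (f t)) x _ _
      (is_derive_sin _) f2; apply: (is_derive_eq h); rewrite mulrC.
have d1 : cderive_at (fun t => (expR (complex.Re (f t)))%:C) x
   (expR (complex.Re (f x)) * complex.Re l)%:C.
  by split => //=; exact: is_derive_cst.
have d2 : cderive_at (fun t => cos (complex.Im (f t)) +i* sin (complex.Im (f t))) x
   ((- sin (complex.Im (f x)) * complex.Im l) +i*
       (cos (complex.Im (f x)) * complex.Im l)).
  by split.
have := cderiveM d1 d2; congr cderive_at.
by apply: complex_ext; rewrite /cexp !(cReD,cImD,cReM,cImM) /=; ring.
Qed.

Lemma cexp0 : cexp (0 : R[i]) = 1.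
Proof. by apply: complex_ext; rewrite /cexp ?cReM ?cImM/= expR0 cos0 sin0; ring. Qed.

Lemma cexpD z w : cexp (z + w) = cexp z * cexp w.
Proof.
by apply: complex_ext;
  rewrite /cexp !(cReM,cImM,cReD,cImD)/= expRD cosD sinD; ring.
Qed.

Lemma cmod_cexp z : cmod (cexp z) = expR (complex.Re z).
Proof.
rewrite /cexp cmodM cmod_real ger0_norm ?expR_ge0//.
by rewrite /cmod/= cos2Dsin2 sqrtr1 mulr1.
Qed.

Lemma derive_dist_le (f : R -> R) x (l e : R) : is_derive x (1 : R) f l -> 0 < e ->
  exists2 del : R, 0 < del & forall h, `|h| < del ->
    `|f (x + h) - f x - h * l| <= e * `|h|.
Proof.
move=> [fd fl] e0.
have /cvgrPdist_le/(_ e e0) : h^-1 *: ((f \o shift x) (h *: (1 : R)) - f x)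
    @[h --> (0 : R)^'] --> l.
  by rewrite -fl; exact: fd.
rewrite near_withinE => /nbhs_ballP[del/= del0 H].
exists del => // h hdel.
have [->|h0] := eqVneq h 0; first by rewrite addr0 subrr mul0r subr0 normr0 mulr0.
have /(_ _ h0) := H h; rewrite /ball/= sub0r normrN => /(_ hdel).
rewrite /GRing.scale/= mulr1 => Hh.
have -> : f (x + h) - f x - h * l = - (h * (l - h^-1 * (f (h + x) - f x))).
  by rewrite (addrC h x); field.
by rewrite normrN normrM mulrC ler_wpM2r.
Qed.

(** The difference quotient estimate in straddled form: the two endpoints
    surround the point of differentiability. *)
Lemma cderive_straddle f x l (e : R) : cderive_at f x l -> 0 < e ->
  exists2 del : R, 0 < del & forall u v, u <= x <= v -> v - u < del ->
    cmod (f v - f u - (v - u)%:C * l) <= e * (v - u).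
Proof.
move=> [f1 f2] e0.
have e20 : 0 < e / 2 by rewrite divr_gt0.
have [d1 d10 P1] := derive_dist_le f1 e20.
have [d2 d20 P2] := derive_dist_le f2 e20.
exists (Num.min d1 d2) => [|u v /andP[ux xv]]; first by rewrite lt_min d10.
rewrite lt_min => /andP[uv1 uv2].
have := P1 (v - x); have := P1 (u - x); have := P2 (v - x); have := P2 (u - x).
have -> : `|u - x| = x - u by rewrite distrC ger0_norm// subr_ge0.
have -> : `|v - x| = v - x by rewrite ger0_norm// subr_ge0.
rewrite !subrKC => /(_ ltac:(lra)) Q1 /(_ ltac:(lra)) Q2 /(_ ltac:(lra)) Q3
    /(_ ltac:(lra)) Q4.
apply: le_trans (cmod_le_ReIm _) _.
rewrite !(cReD, cReN, cImD, cImN, cReM, cImM)/= !mul0r subr0 addr0.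
move: Q1 Q2 Q3 Q4; rewrite !ler_norml => /andP[a1 a2] /andP[b1 b2] /andP[c1 c2]
    /andP[d1' d2'].
have -> : e * (v - u) = e / 2 * (v - u) + e / 2 * (v - u) by field.
apply: lerD; rewrite ler_norml; apply/andP; split; lra.
Qed.

End ComplexDerivative.

(** * The exponential of a diagonal matrix *)

Section MatrixExponential.
Variable R : realType.
Implicit Types (f g : R -> R[i]) (x : R) (z w l m : R[i]).

(** The factor 2 comes from applying the mean value theorem to the real and
    imaginary parts separately. *)
Lemma cderive_lipschitz f (l : R -> R[i]) (a b M : R) :
  (forall t, a <= t <= b -> cderive_at f t (l t)) ->
  (forall t, a <= t <= b -> cmod (l t) <= M) ->
  forall u v, a <= u -> u <= v -> v <= b -> cmod (f v - f u) <= 2 * M * (v - u).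
Proof.
move=> fl lM u v au uv vb.
have key (F dF : R -> R) : (forall t, a <= t <= b -> is_derive t (1 : R) F (dF t)) ->
    (forall t, a <= t <= b -> `|dF t| <= M) -> `|F v - F u| <= M * (v - u).
  move=> Fd FM.
  have [||c cuv ->] := @MVT_segment R F dF u v uv.
  - move=> t; rewrite in_itv/= => /andP[ut tv]; apply: Fd.
    by rewrite (le_trans au (ltW ut)) (le_trans (ltW tv) vb).
  - apply: derivable_within_continuous => t.
    rewrite in_itv/= => /andP[ut tv]; apply: ex_derive; apply: Fd.
    by rewrite (le_trans au ut) (le_trans tv vb).
  - move: cuv; rewrite in_itv/= => /andP[uc cv].
    rewrite normrM (@ger0_norm _ (v - u)) ?subr_ge0// ler_wpM2r ?subr_ge0//.
    by apply: FM; rewrite (le_trans au uc) (le_trans cv vb).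
apply: le_trans (cmod_le_ReIm _) _.
rewrite cReD cReN cImD cImN -mulrA mulr2n mulrDl mul1r; apply: lerD.
  apply: (key (fun t => complex.Re (f t)) (fun t => complex.Re (l t))) => t tab;
      first by have [] := fl t tab.
  exact: le_trans (normr_Re_le _) (lM t tab).
apply: (key (fun t => complex.Im (f t)) (fun t => complex.Im (l t))) => t tab;
    first by have [] := fl t tab.
exact: le_trans (normr_Im_le _) (lM t tab).
Qed.

(** Partial sum of the exponential series: the n terms of degree less than n. *)
Definition cexp_sum (n : nat) z : R[i] := \sum_(m < n) (m`!%:R)^-1 * z ^+ m.

Lemma cderive_cexp_sum n z x :
  cderive_at (fun t => cexp_sum n.+1 (t%:C * z)) x (z * cexp_sum n (x%:C * z)).
Proof.
have := cderive_sum (fun i : 'I_n.+1 => cderiveZ (i`!%:R)^-1 (cderive_pow z x i)).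
congr cderive_at.
rewrite big_ord_recl /= mul0r mul0r mulr0 add0r /cexp_sum mulr_sumr.
apply: eq_bigr => i _; rewrite /bump /= add1n factS natrM.
have : (i.+1%:R : R[i]) != 0 by rewrite pnatr_eq0.
have : (i`!%:R : R[i]) != 0 by rewrite pnatr_eq0 -lt0n fact_gt0.
rewrite add0n; move: (i`!%:R : R[i]) (i.+1%:R : R[i]) => w k w0 k0.
by field; rewrite w0 k0.
Qed.

Lemma cmod_natV n : cmod ((n%:R)^-1 : R[i]) = (n%:R)^-1.
Proof.
have -> : (n%:R : R[i]) = (n%:R : R)%:C by rewrite rmorph_nat.
by rewrite -fmorphV cmod_real ger0_norm// invr_ge0.
Qed.

Lemma cmodX z n : cmod (z ^+ n) = cmod z ^+ n.
Proof. by elim: n => [|n IH]; rewrite ?expr0 ?cmod1// !exprS cmodM IH. Qed.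

Lemma cmod_cexp_le z : cmod (cexp z) <= expR (cmod z).
Proof. by rewrite cmod_cexp ler_expR (le_trans (ler_norm _)) ?normr_Re_le. Qed.

(** With S_n the partial sum of n terms, the function cexp(- tz) S_(n+1)(tz)
    equals 1 at t = 0, and its derivative - z cexp(- tz) (tz)^n / n! is small
    uniformly in t. *)
Lemma cexp_sum_dist n z :
  cmod (cexp_sum n.+1 z - cexp z) <=
    (2 * cmod z * expR (cmod z) ^+ 2) * exp_coeff (cmod z) n.
Proof.
pose g t := cexp (t%:C * (- z)) * cexp_sum n.+1 (t%:C * z).
pose l t := - z * cexp (t%:C * (- z)) * ((n`!%:R)^-1 * (t%:C * z) ^+ n).
have gl t : cderive_at g t (l t).
  have := cderiveM (cderive_cexp (cderive_lin (- z) t)) (cderive_cexp_sum n z t).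
  congr cderive_at; rewrite /l {1}/cexp_sum big_ord_recr/= -/(cexp_sum n _).
  by ring.
have lb t : 0 <= t <= 1 -> cmod (l t) <= cmod z * expR (cmod z) * exp_coeff (cmod z) n.
  move=> /andP[t0 t1].
  have tz w : cmod (t%:C * w) <= cmod w.
    by rewrite cmodM cmod_real ger0_norm// ler_piMl// cmod_ge0.
  rewrite /l cmodM [cmod (- z * _)]cmodM cmodN -!mulrA.
  apply: ler_wpM2l; first exact: cmod_ge0.
  apply: ler_pM; rewrite ?cmod_ge0//.
    by rewrite (le_trans (cmod_cexp_le _))// ler_expR (le_trans (tz _))// cmodN.
  rewrite cmodM cmod_natV cmodX /exp_coeff/= mulrC ler_wpM2r ?invr_ge0//.
  by apply: lerXn2r; rewrite ?nnegrE ?cmod_ge0.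
have := cderive_lipschitz (a := 0) (b := 1) (fun t _ => gl t) lb (lexx 0) ler01
    (lexx 1).
rewrite subr0 mulr1 => H.
have -> : cexp_sum n.+1 z - cexp z = cexp z * (g 1 - g 0).
  have -> : g 0 = 1.
    rewrite /g rmorph0 !mul0r cexp0 mul1r /cexp_sum big_ord_recl big1 => [|i _].
      by rewrite expr0 mulr1 addr0 fact0 invr1.
    by rewrite expr0n /= mulr0.
  rewrite /g rmorph1 !mul1r mulrBr mulr1 mulrA -cexpD subrr cexp0 mul1r//.
rewrite cmodM; apply: (le_trans (ler_pM _ _ (cmod_cexp_le z) H)); rewrite ?cmod_ge0//.
by rewrite le_eqVlt; apply/orP; left; apply/eqP; rewrite !mulrA; ring.
Qed.

Lemma cexp_sum_cvg z :
  (fun n => complex.Re (cexp_sum n z)) @ \oo --> complex.Re (cexp z) /\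
  (fun n => complex.Im (cexp_sum n z)) @ \oo --> complex.Im (cexp z).
Proof.
have H : (fun n => (2 * cmod z * expR (cmod z) ^+ 2) * exp_coeff (cmod z) n) @ \oo -->
    0.
  rewrite -[X in _ --> X](mulr0 (2 * cmod z * expR (cmod z) ^+ 2)).
  apply: cvgMr; apply: cvg_series_cvg_0; exact: is_cvg_series_exp_coeff.
have key (F : R[i] -> R) (FB : {morph F : x y / x - y})
    (Fle : forall w, `|F w| <= cmod w) :
    (fun n => F (cexp_sum n z)) @ \oo --> F (cexp z).
  rewrite -cvg_shiftS /=; apply/cvgrPdist_le => e e0.
  move/cvgrPdist_le : H => /(_ e e0); apply: filterS => n.
  rewrite sub0r normrN => He; rewrite distrC -FB.
  apply: le_trans (Fle _) _; apply: le_trans (cexp_sum_dist _ _) _.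
  exact: le_trans (ler_norm _) He.
split; apply: key; try by move=> x y; rewrite ?cReD ?cReN ?cImD ?cImN.
  by move=> w; exact: normr_Re_le.
by move=> w; exact: normr_Im_le.
Qed.

Lemma mx22_mul (a b c e a' b' c' e' : R[i]) :
  mx22 a b c e *m mx22 a' b' c' e' =
  mx22 (a * a' + b * c') (a * b' + b * e') (c * a' + e * c') (c * b' + e * e').
Proof.
apply/matrixP => k j; rewrite !mxE !big_ord_recl big_ord0 addr0 !mxE /=.
by case: ifP => _; case: ifP.
Qed.

Lemma mx22_diagX (a b : R[i]) n : mx22 a 0 0 b ^+ n = mx22 (a ^+ n) 0 0 (b ^+ n).
Proof.
elim: n => [|n IH].
  rewrite !expr0; apply/matrixP => k j; rewrite !mxE.
  by case: k => [[|[|//]] ?]; case: j => [[|[|//]] ?].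
by rewrite exprS IH [LHS]mx22_mul !(mul0r, mulr0, addr0, add0r) -!exprS.
Qed.

Lemma mexp_diag (a b : R[i]) :
  mexp (mx22 a 0 0 b) = mx22 (cexp a) 0 0 (cexp b).
Proof.
have H z : limn (fun n => complex.Re (cexp_sum n z)) +i*
           limn (fun n => complex.Im (cexp_sum n z)) = cexp z.
  have [h1 h2] := cexp_sum_cvg z.
  by apply: complex_ext; apply/cvg_lim.
have H0 : limn (fun n => complex.Re (0 : R[i])) +i*
          limn (fun n => complex.Im (0 : R[i])) = 0.
  by rewrite /= lim_cst.
apply/matrixP => k j; rewrite !mxE.
have E n : (\sum_(m < n) m`!%:R^-1 *: mx22 a 0 0 b ^+ m) k j =
   mx22 (cexp_sum n a) 0 0 (cexp_sum n b) k j.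
  rewrite summxE !mxE; under eq_bigr do rewrite mx22_diagX !mxE.
  by case: ifP => _; case: ifP => _ //; rewrite big1// => m _; exact: mulr0.
under eq_fun do rewrite E mxE.
under [X in _ +i* limn X]eq_fun do rewrite E mxE.
by case: ifP => _; case: ifP => _.
Qed.

End MatrixExponential.

(** * Absolutely continuous functions *)

Section AbsoluteContinuity.
Variable R : realType.
Local Notation leb := (@lebesgue_measure R).
Local Notation I01 := (`[(0 : R), (1 : R)]%classic : set R).
Implicit Types (f g : R -> R[i]) (h : R -> R).

(** Real induction over [a, b]: it suffices that P passes from u to v whenever
    u <= x <= v are close enough to x, at every point x. *)
Lemma straddle_induction (P : R -> Prop) (a b : R) : a <= b -> P a ->
  (forall x, a <= x <= b -> exists2 del : R, 0 < del &
    forall u v, a <= u -> u <= x -> x <= v -> v <= b -> v - u < del -> P u -> P v) ->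
  P b.
Proof.
move=> ab Pa step.
pose S := [set x | a <= x <= b /\ P x].
have Sa : S a by split=> //; rewrite lexx.
have ubS : ubound S b by move=> x [/andP[]].
have hS : has_sup S by split; [exists a|exists b].
have ac : a <= sup S by apply: ub_le_sup => //; exists b.
have cb : sup S <= b by apply: ge_sup => //; exists a.
have [del del0 H] := step (sup S) (introT andP (conj ac cb)).
have del20 : 0 < del / 2 by rewrite divr_gt0.
have [u [/andP[au ub] Pu] cu] := sup_adherent del20 hS.
have uc : u <= sup S by apply: ub_le_sup; [exists b|split=> //; rewrite au].
pose v := Num.min b (sup S + del / 4).
have d4 : 0 < del / 4 by rewrite divr_gt0.
have cv : sup S <= v by rewrite /v le_min cb lerDl ltW.
have vb : v <= b by rewrite /v ge_min lexx.
have vd : v <= sup S + del / 4 by rewrite /v ge_min lexx orbT.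
have Pv : P v by apply: (H u v) => //; lra.
have : v <= sup S.
  by apply: ub_le_sup; [exists b|split=> //; rewrite vb (le_trans ac cv)].
rewrite {1}/v ge_min => /orP[bc|]; last by rewrite gerDl leNgt d4.
by have -> : b = v by apply/eqP; rewrite eq_le vb andbT (le_trans bc cv).
Qed.

Lemma ae_imp (P Q : R -> Prop) : {ae leb, forall x, P x} ->
  (forall x, P x -> Q x) -> {ae leb, forall x, Q x}.
Proof.
move=> aP PQ; move: aP.
by apply: filterS; [exact: (ae_filter_ringOfSetsType leb)|exact: PQ].
Qed.

Lemma ae_imp2 (P Q S : R -> Prop) : {ae leb, forall x, P x} ->
  {ae leb, forall x, Q x} -> (forall x, P x -> Q x -> S x) ->
  {ae leb, forall x, S x}.
Proof.
move=> aP aQ PQS; move: aP aQ.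
by apply: filterS2; [exact: (ae_filter_ringOfSetsType leb)|exact: PQS].
Qed.

Lemma ae_neq (a : R) : {ae leb, forall x, x != a}.
Proof.
exists [set a]; split; [exact: measurable_set1|exact: lebesgue_measure_set1|].
by move=> x /= /negP; rewrite negbK => /eqP.
Qed.

Lemma leb_itv_oo (u v : R) : u <= v -> (leb `]u, v[%classic = (v - u)%:E)%E.
Proof.
rewrite lebesgue_measure_itv/= lte_fin.
rewrite le_eqVlt => /predU1P[->|->]; last by rewrite EFinB.
by rewrite ltxx subrr.
Qed.

Lemma Rintegral_cst_oo (u v r : R) : u <= v ->
  (\int[leb]_(_ in `]u, v[) r)%R = r * (v - u).
Proof.
by move=> uv; rewrite Rintegral_cst; [rewrite -[v - u]/(fine (v - u)%:E)
    -leb_itv_oo|exact: measurable_itv].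
Qed.

Lemma sum_itv_le (n : nat) (u v : 'I_n -> R) (O : set R) (r : R) :
  open O -> (leb O < r%:E)%E -> (forall i, u i <= v i) ->
  (forall i, `]u i, v i[%classic `<=` O) ->
  trivIset [set: 'I_n] (fun i => `]u i, v i[%classic) ->
  \sum_(i < n) (v i - u i) < r.
Proof.
move=> oO Or uv uvO tI.
rewrite -lte_fin; apply: le_lt_trans Or.
rewrite -sumEFin; under eq_bigr => i _.
  have -> : (v i - u i)%:E = leb `]u i, v i[%classic.
    rewrite lebesgue_measure_itv/= lte_fin.
    have := uv i; rewrite le_eqVlt => /predU1P[->|->]; last by rewrite EFinB.
    by rewrite ltxx subrr.
  over.
rewrite -(measure_bigsetU_ord leb xpredT (fun i => measurable_itv `]u i, v i[))//.
apply: le_measure; rewrite ?inE.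
- by apply: bigsetU_measurable => i _; exact: measurable_itv.
- exact: measurable_realfun.open_measurable.
- by elim/big_ind : _ => [//|A B AO BO|i _]; [rewrite subUset|exact: uvO].
Qed.

(** A function whose increments are dominated by the integrals of a fixed
    integrable function is absolutely continuous. *)
Lemma abs_cont_dominated f h (c : R) :
  leb.-integrable I01 (EFin \o h) -> (forall x, 0 <= h x) ->
  (forall u v : R, 0 <= u -> u <= v -> v <= 1 ->
     cmod (f v - f u) <= c * (\int[leb]_(t in `]u, v[) h t)%R) ->
  abs_cont f.
Proof.
move=> ih h0 fh e e0.
pose c' := `|c| + 1.
have c'0 : 0 < c' by rewrite ltr_wpDl.
pose hh := h \_ I01.
have ihh : leb.-integrable setT (EFin \o hh).
  by rewrite -restrict_EFin; apply/integrable_restrict => //; rewrite setTI.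
have [del [del0 H]] := integral_normr_continuous ihh (divr_gt0 e0 c'0).
exists del => // n u v uv tI sd.
pose F i := `]u i, v i[%classic : set R.
have mF i : measurable (F i) by exact: measurable_itv.
pose O := \big[setU/set0]_(i < n) F i.
have mO : measurable O by apply: bigsetU_measurable => i _.
have FI i : F i `<=` I01.
  move=> x; rewrite /F/= !in_itv/= => /andP[ux xv].
  have [u0 [_ v1]] := uv i.
  by rewrite (le_trans u0 (ltW ux)) (le_trans (ltW xv) v1).
have OI : O `<=` I01.
  by rewrite /O; elim/big_ind : _ => [//|A B AO BO|i _]; [rewrite subUset|exact: FI].
have /(H _ mO) : (leb O < del%:E)%E.
  rewrite /O measure_bigsetU_ord//.
  rewrite (eq_bigr (fun i => (v i - u i)%:E)) ?sumEFin ?lte_fin// => i _.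
  rewrite /F [LHS]lebesgue_measure_itv/= lte_fin.
  have [_ [+ _]] := uv i; rewrite le_eqVlt => /predU1P[->|->]; last by rewrite EFinB.
  by rewrite ltxx subrr.
have -> : (\int[leb]_(x in O) `|hh x|)%R = \sum_(i < n) (\int[leb]_(x in F i) h x)%R.
  have -> : (\int[leb]_(x in O) `|hh x|)%R = (\int[leb]_(x in O) h x)%R.
    apply: eq_Rintegral => x xO; rewrite /hh patchE mem_set ?ger0_norm//.
    by apply: OI; exact: set_mem.
  have mh := measurable_int leb ih.
  rewrite /Rintegral /O integral_bigsetU_EFin//=; last 3 first.
  - exact: index_enum_uniq.
  - by move=> i j _ _; exact: tI.
  - exact: measurable_funS mh.
  rewrite sum_fine// => i _.
  have iF : leb.-integrable (F i) (EFin \o h).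
    exact: (@integrableS _ _ _ leb I01 (F i) (EFin \o h) (measurable_itv _)
              (mF i) (@FI i) ih).
  by apply: integrable_fin_num; [exact: mF|exact: iF].
rewrite ltr_pdivlMr// => He; apply: le_lt_trans He.
rewrite mulr_suml; apply: ler_sum => i _.
have [u0 [uv' v1]] := uv i.
apply: le_trans (fh _ _ u0 uv' v1) _; rewrite mulrC ler_wpM2l//.
  by apply: Rintegral_ge0.
by rewrite (le_trans (ler_norm _))// lerDl.
Qed.

Lemma abs_cont_lipschitz f (c : R) :
  (forall u v : R, 0 <= u -> u <= v -> v <= 1 -> cmod (f v - f u) <= c * (v - u)) ->
  abs_cont f.
Proof.
move=> fc; apply: (@abs_cont_dominated f (fun=> 1) c) => // [|u v u0 uv v1].
  apply/integrableP; split; first exact: measurable_cst.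
  under eq_integral do rewrite /= normr1.
  rewrite integral_cst//= mul1e lebesgue_measure_itv/= lte_fin ltr01.
  by rewrite -EFinB ltry.
by rewrite Rintegral_cst_oo// mul1r; exact: fc.
Qed.

Lemma abs_contD f g : abs_cont f -> abs_cont g -> abs_cont (fun t => f t + g t).
Proof.
move=> cf cg e e0; have e20 : 0 < e / 2 by rewrite divr_gt0.
have [d1 d10 H1] := cf _ e20; have [d2 d20 H2] := cg _ e20.
exists (Num.min d1 d2) => [|n u v uv tI]; first by rewrite lt_min d10.
rewrite lt_min => /andP[s1 s2].
have := ltrD (H1 _ _ _ uv tI s1) (H2 _ _ _ uv tI s2).
rewrite -splitr; apply: le_lt_trans; rewrite -big_split/=.
apply: ler_sum => i _; apply: le_trans (cmodD _ _).
by rewrite le_eqVlt; apply/orP; left; apply/eqP; congr cmod; ring.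
Qed.

Lemma abs_cont_unif f (e : R) : abs_cont f -> 0 < e ->
  exists2 del : R, 0 < del & forall u v, 0 <= u -> u <= v -> v <= 1 ->
    v - u < del -> cmod (f v - f u) < e.
Proof.
move=> cf e0; have [del del0 H] := cf e e0; exists del => // u v u0 uv v1 uvd.
have := H 1 (fun=> u) (fun=> v); rewrite !big_ord1; apply => //.
by move=> i j _ _ _; rewrite (ord1 i) (ord1 j).
Qed.

Lemma within_continuous_unif (F : R -> R) :
  (forall e : R, 0 < e -> exists2 del : R, 0 < del &
     forall u v : R, 0 <= u -> u <= v -> v <= 1 -> v - u < del -> `|F v - F u| < e) ->
  {within I01, continuous F}.
Proof.
move=> HF; apply/subspace_continuousP => x; rewrite /= in_itv/= => /andP[x0 x1].
apply/cvgrPdist_lt => e /HF[del del0 H].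
rewrite near_withinE; apply/nbhs_ballP; exists del => //= y.
rewrite /ball/= in_itv/= => xy /andP[y0 y1].
have [le|/ltW le] := leP x y.
  by rewrite distrC; apply: H => //; move: xy; rewrite distrC ger0_norm// subr_ge0.
by apply: H => //; move: xy; rewrite ger0_norm// subr_ge0.
Qed.

Lemma abs_cont_within f (F : R[i] -> R) : abs_cont f ->
  (forall z w, `|F z - F w| <= cmod (z - w)) ->
  {within I01, continuous (fun x => F (f x))}.
Proof.
move=> cf HF; apply: within_continuous_unif => e e0.
have [del del0 H] := abs_cont_unif cf e0; exists del => // u v u0 uv v1 uvd.
exact: le_lt_trans (HF _ _) (H _ _ u0 uv v1 uvd).
Qed.

Lemma cmod_distl (z w : R[i]) : `|cmod z - cmod w| <= cmod (z - w).
Proof.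
rewrite ler_norml; apply/andP; split.
  by rewrite lerNl opprB lerBlDr cmodB_sym (le_trans _ (cmodD _ _))// subrK.
by rewrite lerBlDr (le_trans _ (cmodD _ _))// subrK.
Qed.

Lemma abs_cont_within_Re f : abs_cont f ->
  {within I01, continuous (fun x => complex.Re (f x))}.
Proof.
move=> cf; apply: abs_cont_within => // z w.
by rewrite -cReN -cReD; exact: normr_Re_le.
Qed.

Lemma abs_cont_within_Im f : abs_cont f ->
  {within I01, continuous (fun x => complex.Im (f x))}.
Proof.
move=> cf; apply: abs_cont_within => // z w.
by rewrite -cImN -cImD; exact: normr_Im_le.
Qed.

Lemma abs_cont_bounded f : abs_cont f ->
  exists2 M : R, 0 <= M & forall x, 0 <= x <= 1 -> cmod (f x) <= M.
Proof.
move=> cf; have := abs_cont_within cf cmod_distl.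
move=> /(EVT_max (@ler01 R))[c _ H]; exists (cmod (f c)); first exact: cmod_ge0.
by move=> x x01; apply: H; rewrite in_itv.
Qed.

Lemma abs_contM f g : abs_cont f -> abs_cont g -> abs_cont (fun t => f t * g t).
Proof.
move=> cf cg.
have [M M0 fM] := abs_cont_bounded cf; have [N N0 gN] := abs_cont_bounded cg.
move=> e e0; pose K := M + N + 1.
have K0 : 0 < K by rewrite ltr_wpDl// addr_ge0.
have eK : 0 < e / 2 / K by rewrite !divr_gt0.
have [d1 d10 H1] := cf _ eK; have [d2 d20 H2] := cg _ eK.
exists (Num.min d1 d2) => [|n u v uv tI]; first by rewrite lt_min d10.
rewrite lt_min => /andP[s1 s2].
have := ltrD (H1 _ _ _ uv tI s1) (H2 _ _ _ uv tI s2).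
rewrite -mulrDl -splitr ltr_pdivlMr// mulrC; apply: le_lt_trans.
rewrite -big_split/= mulr_sumr; apply: ler_sum => i _.
have [u0 [uv' v1]] := uv i.
have -> : f (v i) * g (v i) - f (u i) * g (u i) =
   (f (v i) - f (u i)) * g (u i) + f (v i) * (g (v i) - g (u i)) by ring.
apply: le_trans (cmodD _ _) _; rewrite !cmodM mulrDr; apply: lerD.
  rewrite mulrC ler_wpM2r ?cmod_ge0// (le_trans (gN _ _)) ?u0 ?(le_trans uv')//.
  by rewrite /K; lra.
rewrite ler_wpM2r ?cmod_ge0// (le_trans (fM _ _)) ?v1 ?(le_trans u0)//.
by rewrite /K; lra.
Qed.

Lemma abs_cont_cst (z : R[i]) : abs_cont (fun=> z).
Proof.
by apply: (@abs_cont_lipschitz _ 0) => u v *; rewrite subrr cmod0 mul0r.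
Qed.

Lemma abs_contN f : abs_cont f -> abs_cont (fun t => - f t).
Proof.
move=> cf; have := abs_contM (abs_cont_cst (-1)) cf.
by congr abs_cont; apply/funext => t; rewrite mulN1r.
Qed.

Lemma abs_cont_cexp (z : R[i]) : abs_cont (fun t => cexp (t%:C * z)).
Proof.
apply: (@abs_cont_lipschitz _ (2 * (cmod z * expR (cmod z)))) => u v u0 uv v1.
apply: (@cderive_lipschitz _ (fun t => cexp (t%:C * z))
          (fun t => z * cexp (t%:C * z)) 0 1) => // t t01.
  exact: cderive_cexp (cderive_lin z t).
rewrite cmodM ler_wpM2l ?cmod_ge0// (le_trans (cmod_cexp_le _))// ler_expR.
move: t01 => /andP[t0 t1].
by rewrite cmodM cmod_real ger0_norm// ler_piMl// cmod_ge0.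
Qed.

(** Lebesgue differentiation for the primitive of a function that is integrable
    on [0,1]; the derivative is two-sided, so the endpoints are discarded. *)
Lemma ae_is_derive_primitive h : leb.-integrable I01 (EFin \o h) ->
  {ae leb, forall x : R, x \in `[0, 1] ->
     is_derive x (1 : R) (fun y => (\int[leb]_(t in `[0%R, y]) h t)%R) (h x)}.
Proof.
move=> ih; pose hh := h \_ I01.
have ihh : leb.-integrable setT (EFin \o hh).
  by rewrite -restrict_EFin; apply/integrable_restrict => //; rewrite setTI.
have iA (A : set R) : measurable A -> leb.-integrable A (EFin \o hh).
  move=> mA; exact: (@integrableS _ _ _ leb setT A (EFin \o hh) measurableT mA
      (@subsetT _ _) ihh).
have := @FTC1 R hh (BLeft 0) (fun y => iA _ (measurable_itv _))
    (integrable_locally (measurable_itv _) ih).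
have xn01 : {ae leb, forall x : R, x != 0 /\ x != 1}.
  by apply: (ae_imp2 (ae_neq 0) (ae_neq 1)).
move=> /ae_imp2 /(_ xn01); apply.
move=> x Hx [xn0 xn1]; rewrite in_itv/= => /andP[x0 x1].
have x0' : 0 < x by rewrite lt_neqAle eq_sym xn0.
have x1' : x < 1 by rewrite lt_neqAle xn1.
have [|d1 d2] := Hx; first by rewrite lte_fin.
have hhx : hh x = h x by rewrite /hh patchE mem_set//= in_itv/= x0 x1.
rewrite derive1E hhx in d2.
apply: near_eq_is_derive (DeriveDef d1 d2).
have : \forall y \near x, y < 1 by exact: lt_nbhsl.
apply: filterS => y y1; apply: eq_Rintegral => t /set_mem /=.
rewrite in_itv/= => /andP[t0 ty].
by rewrite /hh patchE mem_set//= in_itv/= t0 (le_trans ty (ltW y1)).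
Qed.

(** The fundamental theorem of calculus for absolutely continuous functions,
    as an inequality.  The points of non-differentiability lie in an open set
    of small measure, on which the total increment of f is small; everywhere
    else the increments of f are dominated by those of the integral of h, up
    to a small multiple of the length. *)
Lemma abs_cont_le_integral f h : abs_cont f ->
  leb.-integrable I01 (EFin \o h) -> (forall x, 0 <= h x) ->
  {ae leb, forall x, x \in `[0, 1] ->
     exists2 l, cderive_at f x l & cmod l <= h x} ->
  forall x : R, 0 <= x <= 1 -> cmod (f x - f 0) <= (\int[leb]_(t in `[0, x]) h t)%R.
Proof.
move=> cf ih h0 fh b /andP[b0 b1].
pose H x := (\int[leb]_(t in `[0%R, x]) h t)%R.
have iA (u v : R) : 0 <= u -> v <= 1 -> leb.-integrable `[u, v] (EFin \o h).
  move=> u0 v1; apply: (@integrableS _ _ _ leb I01 _ (EFin \o h) (measurable_itv _)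
      (measurable_itv _) _ ih).
  move=> t; rewrite /= !in_itv/= => /andP[ut tv].
  by rewrite (le_trans u0 ut) (le_trans tv v1).
have Hmono (u v : R) : 0 <= u -> u <= v -> v <= 1 -> H u <= H v.
  move=> u0 uv v1; rewrite -subr_ge0 /H Rintegral_itvB//.
  - by apply: Rintegral_ge0.
  - exact: iA.
have H0 : H 0 = 0 by rewrite /H set_itv1 Rintegral_set1.
have dH := ae_is_derive_primitive ih.
rewrite -/(H b).
apply/ler_addgt0Pr => e e0.
have e20 : 0 < e / 2 by rewrite divr_gt0.
have [del del0 acf] := cf _ e20.
have [N [mN N0 subN]] : {ae leb, forall x : R, x \in `[0, 1] ->
    (exists2 l, cderive_at f x l & cmod l <= h x) /\ is_derive x (1 : R) H (h x)}.
  apply: (ae_imp2 fh dH) => x fx dx x01; by split; [exact: fx|exact: dx].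
have [W [hW NW leW]] : exists W : set R, [/\ open W, N `<=` W & (leb W < del%:E)%E].
  have N0' : lebesgue_measure N = 0%E := N0.
  have Ny : (lebesgue_measure N < +oo)%E by rewrite N0' ltry.
  have [W [hW NW WN]] := @lebesgue_regularity_outer R N del mN Ny del0.
  have : (lebesgue_measure (N `|` (W `\` N)) =
          lebesgue_measure N + lebesgue_measure (W `\` N))%E.
    apply: measureU => //.
      by apply: measurableD => //; exact: measurable_realfun.open_measurable.
    by rewrite setDIK.
  by rewrite setDUK// N0' add0e => WE; exists W; split => //; rewrite WE.
(* P y bounds the increment over [0, y] by the integral of h, up to e y / 2
   and to the increments over finitely many disjoint intervals inside W. *)
pose P y := exists n (u v : 'I_n -> R),
  [/\ forall i, [/\ 0 <= u i, u i <= v i, v i <= y & `]u i, v i[%classic `<=` W],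
      trivIset [set: 'I_n] (fun i => `]u i, v i[%classic) &
      cmod (f y - f 0) <= H y + e / 2 * y + \sum_(i < n) cmod (f (v i) - f (u i))].
have : P b.
  apply: (straddle_induction b0).
    exists 0%N, (fun=> 0), (fun=> 0); split.
    - by case.
    - by case.
    - by rewrite subrr cmod0 H0 big_ord0 mulr0 !addr0.
  move=> x /andP[x0 xb].
  have x01 : x \in `[0, 1] by rewrite in_itv/= x0 (le_trans xb b1).
  have [xN|xN] := pselect (N x).
    (* near an exceptional point, the interval ]u, v[ is added to the family *)
    have /nbhs_ballP[r/= r0 xrW] := open_nbhs_nbhs (conj hW (NW _ xN)).
    exists r => // u v u0 ux xv vb uvr [n [uu [vv [uvP tI fu]]]].
    pose U (i : 'I_n.+1) := if unlift ord_max i is Some j then uu j else u.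
    pose V (i : 'I_n.+1) := if unlift ord_max i is Some j then vv j else v.
    exists n.+1, U, V; split.
    - move=> i; rewrite /U /V; case: unliftP => [j _|_].
        by have [? ? vvu ?] := uvP j; split => //;
            rewrite (le_trans vvu)// (le_trans ux).
      split=> //; first exact: le_trans xv.
      move=> t; rewrite /= in_itv/= => /andP[ut tv]; apply: xrW.
      by rewrite /ball/= ltr_norml; apply/andP; split; lra.
    - move=> i j _ _; rewrite /U /V.
      case: unliftP => [i' ->|->]; case: unliftP => [j' ->|->] // [t []] /=.
      + by move=> ti tj; congr lift; apply: tI => //; exists t.
      + rewrite !in_itv/= => /andP[_ tv] /andP[ut _].
        have [_ _ vvu _] := uvP i'.
        by have := lt_trans ut (lt_le_trans tv vvu); rewrite ltxx.
      + rewrite !in_itv/= => /andP[ut _] /andP[_ tv].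
        have [_ _ vvu _] := uvP j'.
        by have := lt_trans ut (lt_le_trans tv vvu); rewrite ltxx.
    - rewrite big_ord_recr/= /U /V unlift_none.
      under eq_bigr => i _.
        have -> : widen_ord (leqnSn n) i = lift ord_max i.
          by apply/val_inj; rewrite /= /bump leqNgt ltn_ord.
        rewrite liftK; over.
      have -> : f v - f 0 = (f u - f 0) + (f v - f u) by ring.
      apply: le_trans (cmodD _ _) _; rewrite addrA lerD2r.
      apply: le_trans fu _; rewrite lerD2r; apply: lerD.
        by apply: Hmono => //; [exact: le_trans xv|exact: le_trans b1].
      by apply: ler_wpM2l; [exact: ltW|exact: le_trans xv].
  have [[l dfl lh] dHx] := contrapT (fun nx => xN (subN x nx)) x01.
  have e40 : 0 < e / 4 by rewrite divr_gt0.
  have [d1 d10 Hd1] := cderive_straddle dfl e40.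
  have dHC : cderive_at (fun t => (H t)%:C) x (h x)%:C.
    by split => //=; exact: is_derive_cst.
  have [d2 d20 Hd2] := cderive_straddle dHC e40.
  exists (Num.min d1 d2) => [|u v u0 ux xv vb]; first by rewrite lt_min d10.
  rewrite lt_min => /andP[uv1 uv2] [n [uu [vv [uvP tI fu]]]].
  exists n, uu, vv; split => // [i|].
    by have [? ? vvu ?] := uvP i; split => //; rewrite (le_trans vvu)// (le_trans ux).
  have uxv : u <= x <= v by rewrite ux.
  have := Hd1 _ _ uxv uv1; have := Hd2 _ _ uxv uv2.
  rewrite -!rmorphB -rmorphM -rmorphB cmod_real ler_norml => /andP[A _] B.
  have C : cmod (f v - f u) <= (v - u) * h x + e / 4 * (v - u).
    have -> : f v - f u = (v - u)%:C * l + (f v - f u - (v - u)%:C * l) by ring.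
    apply: le_trans (cmodD _ _) _; apply: lerD => //.
    have vu0 : 0 <= v - u by rewrite subr_ge0 (le_trans ux).
    by rewrite cmodM cmod_real ger0_norm// ler_wpM2l.
  have : cmod (f v - f 0) <= cmod (f u - f 0) + cmod (f v - f u).
    by apply: le_trans (cmodD _ _); rewrite (_ : f u - f 0 + _ = f v - f 0)//; ring.
  lra.
move=> [n [u [v [uvP tI]]]] /le_trans; apply.
have su : \sum_(i < n) cmod (f (v i) - f (u i)) < e / 2.
  apply: acf => //.
    by move=> i; have [? ? vb _] := uvP i; rewrite (le_trans vb).
  by apply: (sum_itv_le hW) => // i; have [] := uvP i.
have : e / 2 * b <= e / 2 by rewrite ler_piMr// ltW.
lra.
Qed.

End AbsoluteContinuity.

(** * Square-integrable functions *)

Section SquareIntegrable.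
Variable R : realType.
Local Notation leb := (@lebesgue_measure R).
Local Notation I01 := (`[(0 : R), (1 : R)]%classic : set R).
Implicit Types (A : set R) (f g : R -> R).

(** Real functions that are measurable on a set, with an integrable square. *)
Definition sq_integrable A f :=
  measurable_fun A f /\ leb.-integrable A (EFin \o (fun x => f x ^+ 2)).

Lemma sq_integrableS A (B : set R) f : measurable A -> measurable B -> B `<=` A ->
  sq_integrable A f -> sq_integrable B f.
Proof.
move=> mA mB BA [mf if2]; split; first exact: measurable_funS mf.
exact: (@integrableS _ _ _ leb A B (EFin \o (fun x => f x ^+ 2)) mA mB BA if2).
Qed.

Lemma integrable_le A f g : measurable A -> measurable_fun A f ->
  leb.-integrable A (EFin \o g) -> (forall x, A x -> `|f x| <= g x) ->
  leb.-integrable A (EFin \o f).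
Proof.
move=> mA mf ig fg; apply: (@le_integrable _ _ _ leb A mA (EFin \o f) (EFin \o g) _ _
    ig).
  exact/measurable_EFinP.
by move=> x Ax; rewrite /= lee_fin (le_trans (fg x Ax))// ler_norm.
Qed.

Lemma integrableD_EFin A f g : measurable A -> leb.-integrable A (EFin \o f) ->
  leb.-integrable A (EFin \o g) -> leb.-integrable A (EFin \o (fun x => f x + g x)).
Proof. by move=> mA i1 i2; exact: (@integrableD _ _ _ leb A mA (EFin \o f)
    (EFin \o g)). Qed.

Lemma integrableZ_EFin A f (r : R) : measurable A -> leb.-integrable A (EFin \o f) ->
  leb.-integrable A (EFin \o (fun x => r * f x)).
Proof. by move=> mA i1; exact: (@integrableZl _ _ _ leb A mA r (EFin \o f)). Qed.

Lemma sq_integrableM A f g : measurable A -> sq_integrable A f ->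
  sq_integrable A g -> leb.-integrable A (EFin \o (fun x => f x * g x)).
Proof.
move=> mA [mf if2] [mg ig2].
apply: (@integrable_le _ _ (fun x => f x ^+ 2 + g x ^+ 2)) => //.
- exact: measurable_funM.
- exact: integrableD_EFin.
- move=> x _; rewrite ler_norml; apply/andP; split.
    by have := sqr_ge0 (f x + g x); have := sqr_ge0 (f x); have := sqr_ge0 (g x);
       rewrite sqrrD; lra.
  by have := sqr_ge0 (f x - g x); have := sqr_ge0 (f x); have := sqr_ge0 (g x);
    rewrite sqrrB; lra.
Qed.

(** The Cauchy-Schwarz inequality, by optimizing over s the pointwise bound
    2 f g <= s f^2 + g^2 / s. *)
Lemma Rintegral_mul_le A f g : measurable A -> sq_integrable A f ->
  sq_integrable A g ->
  (\int[leb]_(x in A) (f x * g x))%R <=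
  Num.sqrt (\int[leb]_(x in A) (f x ^+ 2))%R * Num.sqrt
      (\int[leb]_(x in A) (g x ^+ 2))%R.
Proof.
move=> mA sf sg; have ifg := sq_integrableM mA sf sg.
have [[mf if2] [mg ig2]] := (sf, sg).
set a := Num.sqrt _; set b := Num.sqrt _.
have a2 : a ^+ 2 = (\int[leb]_(x in A) (f x ^+ 2))%R.
  by rewrite sqr_sqrtr//; apply: Rintegral_ge0 => x _; exact: sqr_ge0.
have b2 : b ^+ 2 = (\int[leb]_(x in A) (g x ^+ 2))%R.
  by rewrite sqr_sqrtr//; apply: Rintegral_ge0 => x _; exact: sqr_ge0.
have a0 : 0 <= a by exact: sqrtr_ge0.
have b0 : 0 <= b by exact: sqrtr_ge0.
have key s : 0 < s -> (\int[leb]_(x in A) (f x * g x))%R <=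
    (s * a ^+ 2 + s^-1 * b ^+ 2) / 2.
  move=> s0; rewrite ler_pdivlMr// a2 b2 -!RintegralZl// -RintegralD//; last 2 first.
  - exact: integrableZ_EFin.
  - exact: integrableZ_EFin.
  rewrite mulrC -RintegralZl//.
  apply: le_Rintegral => //.
  - exact: integrableZ_EFin.
  - by apply: integrableD_EFin => //; exact: integrableZ_EFin.
  - move=> x _; have := sqr_ge0 (s * f x - g x).
    rewrite sqrrB exprMn => H.
    rewrite -(ler_pM2l s0) mulrDr !mulrA mulfV ?gt_eqF// mul1r.
    by move: H; lra.
apply/ler_addgt0Pr => e e0.
(* the choice s = (b + r) / (a + r) bounds the integral by (a + r) (b + r) *)
pose r := Num.min 1 (e / (a + b + 1)).
have abp : 0 < a + b + 1 by rewrite ltr_wpDl// addr_ge0.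
have r0 : 0 < r by rewrite lt_min ltr01 divr_gt0.
have r1 : r <= 1 by rewrite ge_min lexx.
have re : r * (a + b + 1) <= e by rewrite -ler_pdivlMr// ge_min lexx orbT.
have ar : 0 < a + r by rewrite ltr_wpDl.
have br : 0 < b + r by rewrite ltr_wpDl.
apply: le_trans (key ((b + r) / (a + r)) _) _; first exact: divr_gt0.
have h1 : (b + r) / (a + r) * a ^+ 2 <= (a + r) * (b + r).
  rewrite mulrAC ler_pdivrMr// -mulrA mulrC -subr_ge0.
  rewrite (_ : _ - _ = (b + r) * (r * (2 * a + r))); last by ring.
  by rewrite !mulr_ge0// ?addr_ge0 ?mulr_ge0// ltW.
have h2 : ((b + r) / (a + r))^-1 * b ^+ 2 <= (a + r) * (b + r).
  rewrite invf_div mulrAC ler_pdivrMr// -mulrA ler_pM2l// -expr2.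
  by apply: lerXn2r; rewrite ?nnegrE ?(ltW br) ?lerDl ?(ltW r0).
have : (a + r) * (b + r) = a * b + r * (a + b + r) by ring.
have : r * (a + b + r) <= r * (a + b + 1) by rewrite ler_pM2l//; lra.
lra.
Qed.

Lemma sq_integrable_within f : {within I01, continuous f} -> sq_integrable I01 f.
Proof.
move=> cf; split.
  exact: subspace_continuous_measurable_fun.
apply: continuous_compact_integrable; first exact: segment_compact.
move=> x; apply: (@continuous_comp _ _ _ (f : subspace I01 -> R) (fun y => y ^+ 2)).
  exact: cf.
exact: exprn_continuous.
Qed.

Lemma fin_num_integral A f : measurable A -> leb.-integrable A (EFin \o f) ->
  (\int[leb]_(x in A) (f x)%:E)%E \is a fin_num.
Proof. by move=> mA i1; exact: integrable_fin_num. Qed.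

Lemma Rintegral_subset_le A (B : set R) f : measurable A -> measurable B -> A `<=` B ->
  leb.-integrable B (EFin \o f) -> (forall x, 0 <= f x) ->
  (\int[leb]_(x in A) f x)%R <= (\int[leb]_(x in B) f x)%R.
Proof.
move=> mA mB AB iB f0; rewrite /Rintegral fine_le//.
- apply: integrable_fin_num => //.
  exact: (@integrableS _ _ _ leb B A (EFin \o f) mB mA AB iB).
- exact: integrable_fin_num.
- apply: ge0_subset_integral => //.
    exact: (measurable_int leb iB).
  by move=> x _; rewrite lee_fin.
Qed.

End SquareIntegrable.

Section ComplexL2.
Variable R : realType.
Local Notation leb := (@lebesgue_measure R).
Local Notation I01 := (`[(0 : R), (1 : R)]%classic : set R).
Implicit Types (f g e : R -> R[i]).

Lemma cmodE (z : R[i]) : cmod z = Num.sqrt (complex.Re z ^+ 2 + complex.Im z ^+ 2).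
Proof. by case: z. Qed.

Lemma measurable_cmod (A : set R) f : measurable_fun A (fun x => complex.Re (f x)) ->
  measurable_fun A (fun x => complex.Im (f x)) -> measurable_fun A
      (fun x => cmod (f x)).
Proof.
move=> m1 m2; rewrite (_ : (fun x => _) = Num.sqrt \o
    (fun x => complex.Re (f x) ^+ 2 + complex.Im (f x) ^+ 2)); last first.
  by apply/funext => x; rewrite cmodE.
apply: measurableT_comp.
  exact: continuous_measurable_fun (@sqrt_continuous R).
by apply: measurable_funD; apply: measurable_funX.
Qed.

Lemma eL2norm_integral f :
  (eL2norm f = (\int[leb]_(x in I01) (cmod (f x) ^+ 2)%:E) `^ 2^-1)%E.
Proof.
rewrite /eL2norm unlock /Lnorm [in RHS]integral_mkcond; congr (_ `^ _)%E.
apply: eq_integral => x _; rewrite !patchE; case: ifP => _.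
  by rewrite /= ger0_norm ?cmod_ge0// powR_mulrn ?cmod_ge0.
by rewrite abse0 poweR_EFin powR0.
Qed.

Lemma inL2_sq_integrable f : inL2 f -> sq_integrable I01 (fun x => cmod (f x)).
Proof.
move=> [m1 m2]; rewrite eL2norm_integral => fy.
have mc := measurable_cmod m1 m2; split => //.
apply/integrableP; split.
  by apply/measurable_EFinP; exact: measurable_funX.
under eq_integral => x _ do rewrite /= ger0_norm ?sqr_ge0//.
move: fy; case: (integral _ _ _) => [r||] //; rewrite ?ltry//.
by rewrite /= invr_eq0 pnatr_eq0.
Qed.

Lemma sq_integrable_inL2 f : measurable_fun I01 (fun x => complex.Re (f x)) ->
  measurable_fun I01 (fun x => complex.Im (f x)) ->
  sq_integrable I01 (fun x => cmod (f x)) -> inL2 f.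
Proof.
move=> m1 m2 [_ i2]; split => //; rewrite eL2norm_integral.
have := fin_num_integral (measurable_itv _) i2.
rewrite /=; case: (integral _ _ _) => [r||]//= _.
by rewrite ltry.
Qed.

Lemma L2normE f : inL2 f ->
  L2norm f = Num.sqrt (\int[leb]_(x in I01) (cmod (f x) ^+ 2))%R.
Proof.
move=> /inL2_sq_integrable[_ i2]; rewrite /L2norm eL2norm_integral /Rintegral.
have := fin_num_integral (measurable_itv _) i2.
have : (0 <= \int[leb]_(x in I01) (cmod (f x) ^+ 2)%:E)%E.
  by apply: integral_ge0 => x _; rewrite lee_fin sqr_ge0.
rewrite /=; case: (integral _ _ _) => [r||]//=.
by rewrite lee_fin => r0 _; rewrite powR12_sqrt.
Qed.

Lemma L2norm_ge0 f : 0 <= L2norm f.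
Proof. by apply: fine_ge0; exact: Lnorm_ge0. Qed.

(** Multiplication of an L_2 function by an absolutely continuous function. *)
Lemma inL2_mul_bounded f g (K : R) : inL2 f -> abs_cont g -> 0 <= K ->
  (forall x, 0 <= x <= 1 -> cmod (g x) <= K) ->
  inL2 (fun x => g x * f x) /\ L2norm (fun x => g x * f x) <= K * L2norm f.
Proof.
move=> fL2 acg K0 gK.
have [mf if2] := inL2_sq_integrable fL2.
have [m1 m2 _] := fL2.
have mg1 : measurable_fun I01 (fun x => complex.Re (g x)) :=
  subspace_continuous_measurable_fun (measurable_itv _) (abs_cont_within_Re acg).
have mg2 : measurable_fun I01 (fun x => complex.Im (g x)) :=
  subspace_continuous_measurable_fun (measurable_itv _) (abs_cont_within_Im acg).
have mgf1 : measurable_fun I01 (fun x => complex.Re (g x * f x)).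
  rewrite (_ : (fun x => _) = (fun x => complex.Re (g x) * complex.Re (f x) -
      complex.Im (g x) * complex.Im (f x))); last by apply/funext => x; rewrite cReM.
  by apply: measurable_funB; apply: measurable_funM.
have mgf2 : measurable_fun I01 (fun x => complex.Im (g x * f x)).
  rewrite (_ : (fun x => _) = (fun x => complex.Re (g x) * complex.Im (f x) +
      complex.Im (g x) * complex.Re (f x))); last by apply/funext => x; rewrite cImM.
  by apply: measurable_funD; apply: measurable_funM.
have le x : I01 x -> cmod (g x * f x) ^+ 2 <= K ^+ 2 * cmod (f x) ^+ 2.
  rewrite /= in_itv/= => x01; rewrite cmodM exprMn ler_wpM2r ?sqr_ge0//.
  by apply: lerXn2r; rewrite ?nnegrE ?cmod_ge0// gK.
have igf : leb.-integrable I01 (EFin \o (fun x => cmod (g x * f x) ^+ 2)).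
  apply: (@integrable_le _ _ _ (fun x => K ^+ 2 * cmod (f x) ^+ 2)) => //.
  - by apply: measurable_funX; exact: measurable_cmod.
  - exact: integrableZ_EFin.
  - by move=> x x01; rewrite ger0_norm ?sqr_ge0// le.
have gfL2 : inL2 (fun x => g x * f x).
  by apply: sq_integrable_inL2 => //; split=> //; exact: measurable_cmod.
split=> //; rewrite !L2normE// -(ger0_norm K0) -sqrtr_sqr -sqrtrM ?sqr_ge0//.
apply: ler_wsqrtr; rewrite -RintegralZl//.
by apply: le_Rintegral => //; exact: integrableZ_EFin.
Qed.

Lemma abs_cont_inL2 f : abs_cont f -> inL2 f.
Proof.
move=> cf; apply: sq_integrable_inL2.
- exact: subspace_continuous_measurable_fun (measurable_itv _) (abs_cont_within_Re cf).
- exact: subspace_continuous_measurable_fun (measurable_itv _) (abs_cont_within_Im cf).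
- by apply: sq_integrable_within; apply: abs_cont_within cf _; exact: cmod_distl.
Qed.

End ComplexL2.

(** * Primitives of L_2 functions *)

Section ComplexPrimitive.
Variable R : realType.
Local Notation leb := (@lebesgue_measure R).
Local Notation I01 := (`[(0 : R), (1 : R)]%classic : set R).
Implicit Types (f g e : R -> R[i]).

Lemma inL2_integrable e : inL2 e -> leb.-integrable I01 (EFin \o (fun x => cmod (e x))).
Proof.
move=> /inL2_sq_integrable s.
have s1 : sq_integrable I01 (fun=> 1 : R).
  by apply: sq_integrable_within => x; exact: cst_continuous.
have := sq_integrableM (measurable_itv _) s s1.
by rewrite (_ : (fun x => _ * 1) = (fun x => cmod (e x)))//; apply/funext => x;
    rewrite mulr1.
Qed.

Lemma inL2_integrable_Re e : inL2 e ->
  leb.-integrable I01 (EFin \o (fun x => complex.Re (e x))).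
Proof.
move=> eL2; have [m1 _ _] := eL2.
apply: (integrable_le (measurable_itv _) m1 (inL2_integrable eL2)) => x _.
exact: normr_Re_le.
Qed.

Lemma inL2_integrable_Im e : inL2 e ->
  leb.-integrable I01 (EFin \o (fun x => complex.Im (e x))).
Proof.
move=> eL2; have [_ m1 _] := eL2.
apply: (integrable_le (measurable_itv _) m1 (inL2_integrable eL2)) => x _.
exact: normr_Im_le.
Qed.

Lemma itv_sub01 (i : interval R) : (forall x, x \in i -> 0 <= x <= 1) ->
  [set` i] `<=` I01.
Proof. by move=> H x /H; rewrite /= in_itv. Qed.

Lemma primitive_increment_le (h k : R -> R) (u v : R) :
  leb.-integrable I01 (EFin \o h) -> leb.-integrable I01 (EFin \o k) ->
  (forall x, `|h x| <= k x) -> 0 <= u -> u <= v -> v <= 1 ->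
  `|(\int[leb]_(t in `[0%R, v]) h t)%R - (\int[leb]_(t in `[0%R, u]) h t)%R| <=
  (\int[leb]_(t in `]u, v[) k t)%R.
Proof.
move=> ih ik hk u0 uv v1.
have sub (i : interval R) (f : R -> R) : (forall x, x \in i -> 0 <= x <= 1) ->
    leb.-integrable I01 (EFin \o f) -> leb.-integrable [set` i] (EFin \o f).
  move=> H i1; exact: (@integrableS _ _ _ leb I01 _ (EFin \o f)
    (measurable_itv _) (measurable_itv _) (itv_sub01 H) i1).
have inh : leb.-integrable I01 (EFin \o (fun x => `|h x|)).
  apply: (@integrable_le _ I01 (fun x => `|h x|) k) => // [|x _].
    by apply: measurableT_comp => //; apply/measurable_EFinP;
        exact: (measurable_int leb ih).
  by rewrite normr_id.
rewrite Rintegral_itvB ?bnd_simp//; last first.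
  by apply: sub => // x; rewrite in_itv/= => /andP[-> xv]; exact: le_trans v1.
have Huv x : x \in `]u, v] -> 0 <= x <= 1.
  by rewrite in_itv/= => /andP[ux xv]; rewrite (le_trans u0 (ltW ux)) (le_trans xv v1).
apply: (le_trans (le_normr_Rintegral _ _)); [exact: measurable_itv|exact: sub|].
have Huv' x : x \in `]u, v[ -> 0 <= x <= 1.
  by rewrite in_itv/= => /andP[ux xv]; rewrite (le_trans u0 (ltW ux))
      (le_trans (ltW xv) v1).
rewrite -Rintegral_itv_bndo_bndc; last exact: (sub _ _ Huv' inh).
by apply: le_Rintegral => [||| x _]; 
  [exact: measurable_itv|exact: (sub _ _ Huv' inh)|exact: sub|exact: hk].
Qed.

Lemma abs_cont_cint e : inL2 e -> abs_cont (fun x => cint x e).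
Proof.
move=> eL2; apply: (@abs_cont_dominated _ _ (fun x => cmod (e x)) 2).
- exact: inL2_integrable.
- by move=> x; exact: cmod_ge0.
- move=> u v u0 uv v1; apply: le_trans (cmod_le_ReIm _) _.
  rewrite mulr2n mulrDl mul1r cReD cReN cImD cImN /cint/=; apply: lerD.
  + apply: primitive_increment_le => //; [exact: inL2_integrable_Re|exact:
      inL2_integrable|].
    by move=> x; exact: normr_Re_le.
  + apply: primitive_increment_le => //; [exact: inL2_integrable_Im|exact:
      inL2_integrable|].
    by move=> x; exact: normr_Im_le.
Qed.

Lemma cint0 e : cint 0 e = 0.
Proof. by rewrite /cint set_itv1 !Rintegral_set1. Qed.

Lemma ae_cderive_cint e : inL2 e ->
  {ae leb, forall x : R, x \in `[0, 1] -> cderive_at (fun y => cint y e) x (e x)}.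
Proof.
move=> eL2; have d1 := ae_is_derive_primitive (inL2_integrable_Re eL2).
have d2 := ae_is_derive_primitive (inL2_integrable_Im eL2).
by apply: (ae_imp2 d1 d2) => x h1 h2 x01; split; [exact: h1|exact: h2].
Qed.

(** The increment of an absolutely continuous function whose derivative is
    dominated by the product of an L_2 function and a weight. *)
Lemma abs_cont_L2_bound f e (w : R -> R) : abs_cont f -> inL2 e ->
  sq_integrable I01 w -> (forall x, 0 <= w x) ->
  {ae leb, forall x : R, x \in `[0, 1] ->
     exists2 l, cderive_at f x l & cmod l <= cmod (e x) * w x} ->
  forall x : R, 0 <= x <= 1 ->
  cmod (f x - f 0) <= L2norm e * Num.sqrt (\int[leb]_(t in `[0%R, x]) (w t ^+ 2))%R.
Proof.
move=> cf eL2 sw w0 df x x01.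
have se := inL2_sq_integrable eL2.
have mI : measurable I01 by exact: measurable_itv.
have mx : measurable (`[0, x]%classic : set R) by exact: measurable_itv.
have sub : `[0, x] `<=` I01.
  by apply: itv_sub01 => t; rewrite in_itv/= => /andP[-> tx]; case/andP: x01 => _;
      exact: le_trans.
have := abs_cont_le_integral cf (sq_integrableM mI se sw)
  (fun t => mulr_ge0 (cmod_ge0 _) (w0 t)) df x01.
move=> /le_trans; apply.
apply: le_trans (Rintegral_mul_le mx (sq_integrableS mI mx sub se)
    (sq_integrableS mI mx sub sw)) _.
apply: ler_wpM2r; first exact: sqrtr_ge0.
rewrite L2normE//; apply: ler_wsqrtr; apply: Rintegral_subset_le => //.
  by case: se.
by move=> t; exact: sqr_ge0.
Qed.

Lemma Rintegral_expR_le (lam x : R) : 0 < lam -> 0 <= x <= 1 ->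
  (\int[leb]_(t in `[0%R, x]) (expR (lam * t) ^+ 2))%R <= expR (lam * x) ^+ 2 /
      (2 * lam).
Proof.
move=> lam0 /andP[]; rewrite le_eqVlt => /predU1P[<- _|x0 _].
  by rewrite set_itv1 Rintegral_set1 divr_ge0 ?exprn_ge0 ?expR_ge0 ?mulr_ge0// ltW.
have l20 : 0 < 2 * lam by rewrite mulr_gt0.
have eE t : expR (lam * t) ^+ 2 = expR (2 * lam * t).
  by rewrite expr2 -expRD; congr expR; ring.
pose F t := expR (2 * lam * t) / (2 * lam).
have dF t : is_derive t (1 : R) F (expR (2 * lam * t)).
  have dl : is_derive t (1 : R) (fun t => 2 * lam * t) (2 * lam).
    have h := @is_deriveZ _ _ _ (@id R) (2 * lam) t (1 : R) 1 (is_derive_id t 1).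
    by apply: (is_derive_eq h); rewrite /GRing.scale/= mulr1.
  have h1 := @is_derive1_comp R expR (fun t => 2 * lam * t) t _ _ (is_derive_expR _) dl.
  have h2 := @is_deriveZ _ _ _ (expR \o (fun t => 2 * lam * t)) ((2 * lam)^-1) t
      (1 : R) _ h1.
  rewrite (_ : F = (2 * lam)^-1 *: (expR \o (fun t => 2 * lam * t))); last first.
    by apply/funext => s; rewrite /F mulrC.
  apply: (is_derive_eq h2).
  by rewrite /GRing.scale/= mulrC mulfK// gt_eqF.
have cF t : {for t, continuous F}.
  by apply: differentiable_continuous; apply/derivable1_diffP; exact: ex_derive.
have cE : continuous (fun t : R => expR (2 * lam * t)).
  move=> t; apply: (@continuous_comp _ _ _ (fun t : R => 2 * lam * t) expR).
    exact: mulrl_continuous.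
  exact: continuous_expR.
rewrite (_ : (\int[leb]_(t in _) _)%R = F x - F 0).
  by rewrite /F mulr0 expR0 eE gerBl divr_ge0// ltW.
rewrite /Rintegral; under eq_integral do rewrite eE.
rewrite (@continuous_FTC2 _ _ F)//.
- exact: continuous_subspaceT.
- split.
  + by move=> t _; exact: ex_derive.
  + exact: cvg_at_right_filter (cF 0).
  + exact: cvg_at_left_filter (cF x).
- by move=> t _; rewrite derive1E; exact: derive_val.
Qed.

Lemma sqrt_Rintegral_affine_le (E : R -> R[i]) (a b x : R) : inL2 E -> 0 <= a -> 0 <=
    b ->
  0 <= x <= 1 ->
  Num.sqrt (\int[leb]_(t in `[0%R, x]) ((a * cmod (E t) + b) ^+ 2))%R <= a * L2norm E
      + b.
Proof.
move=> EL2 a0 b0 x01.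
have sE := inL2_sq_integrable EL2; have [mE iE2] := sE.
have iE := inL2_integrable EL2.
have mI : measurable I01 by exact: measurable_itv.
have mx : measurable (`[0, x]%classic : set R) by exact: measurable_itv.
have sub : `[0, x] `<=` I01.
  by apply: itv_sub01 => t; rewrite in_itv/= => /andP[-> tx]; case/andP: x01 => _;
      exact: le_trans.
have s1 : sq_integrable I01 (fun=> 1 : R).
  by apply: sq_integrable_within => t; exact: cst_continuous.
have i1 : leb.-integrable I01 (EFin \o (fun=> b ^+ 2)).
  apply: (@continuous_compact_integrable R (fun=> b ^+ 2) I01).
    exact: segment_compact.
  by move=> t; exact: cst_continuous.
have I1 r : (\int[leb]_(t in I01) (r : R))%R = r.
  rewrite Rintegral_cst//.
  rewrite (_ : fine _ = 1) ?mulr1//.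
  rewrite -[RHS]/(fine (1 : R)%:E); congr fine.
  have := lebesgue_measure_itv `[0 : R, 1 : R].
  by rewrite /= lte_fin ltr01 oppr0 adde0.
have Eg : (\int[leb]_(t in I01) cmod (E t))%R <= L2norm E.
  have := Rintegral_mul_le mI sE s1.
  rewrite -L2normE// expr1n I1 sqrtr1 mulr1; apply: le_trans.
  by rewrite le_eqVlt; apply/orP; left; apply/eqP; apply: eq_Rintegral => t _;
      rewrite mulr1.
have c0 : 0 <= a * L2norm E + b by rewrite addr_ge0// mulr_ge0// L2norm_ge0.
rewrite -[leRHS]ger0_norm// -sqrtr_sqr; apply: ler_wsqrtr.
have eqf t : (a * cmod (E t) + b) ^+ 2 = (a ^+ 2 * cmod (E t) ^+ 2 + 2 * a * b * cmod
    (E t)) + b ^+ 2.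
  by ring.
have j1 := integrableZ_EFin (a ^+ 2) mI iE2.
have j2 := integrableZ_EFin (2 * a * b) mI iE.
have j3 := integrableD_EFin mI j1 j2.
have j4 := integrableD_EFin mI j3 i1.
apply: (@le_trans _ _ (\int[leb]_(t in I01) ((a * cmod (E t) + b) ^+ 2))%R).
  apply: Rintegral_subset_le => //; last by move=> t; exact: sqr_ge0.
  by rewrite (_ : (fun t => _) = (fun t => (a ^+ 2 * cmod (E t) ^+ 2 + 2 * a * b *
      cmod (E t)) + b ^+ 2))//;
     apply/funext.
under eq_Rintegral do rewrite eqf.
rewrite RintegralD// I1 RintegralD// RintegralZl// RintegralZl//.
have -> : (\int[leb]_(t in I01) (cmod (E t) ^+ 2))%R = L2norm E ^+ 2.
  by rewrite L2normE// sqr_sqrtr//; apply: Rintegral_ge0 => t _; exact: sqr_ge0.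
have : 2 * a * b * (\int[leb]_(t in I01) cmod (E t))%R <= 2 * a * b * L2norm E.
  by apply: ler_wpM2l => //; rewrite !mulr_ge0.
by move=> H; rewrite sqrrD exprMn; lra.
Qed.

End ComplexPrimitive.

(** * A priori estimates for the reduced system *)

Section SystemEstimates.
Variable R : realType.
Local Notation leb := (@lebesgue_measure R).
Local Notation I01 := (`[(0 : R), (1 : R)]%classic : set R).
Implicit Types (f g e p q E : R -> R[i]).

(** The square root is that of the constant in the bound exp(2 lam x) / (2 lam)
    for the integral of exp(2 lam t) over [0, x]. *)
Lemma abs_cont_exp_bound f e (m M lam : R) : abs_cont f -> inL2 e ->
  L2norm e <= m -> 0 <= M -> 0 < lam ->
  {ae leb, forall x : R, x \in `[0, 1] ->
     exists2 l, cderive_at f x l & cmod l <= cmod (e x) * (M * expR (lam * x))} ->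
  forall x : R, 0 <= x <= 1 ->
  cmod (f x - f 0) <= m * (M * expR (lam * x) / Num.sqrt (2 * lam)).
Proof.
move=> cf eL2 em M0 lam0 df x x01.
have cE (c : R) : continuous (fun t : R => c * expR (lam * t)).
  move=> t; apply: (@continuous_comp _ _ _ (fun t : R => lam * t)
      (fun y => c * expR y)).
    exact: mulrl_continuous.
  apply: (@continuous_comp _ _ _ expR (fun y => c * y)).
    exact: continuous_expR.
  exact: mulrl_continuous.
have sw (c : R) : sq_integrable I01 (fun t => c * expR (lam * t)).
  by apply: sq_integrable_within; exact: continuous_subspaceT.
have w0 t : 0 <= M * expR (lam * t) by rewrite mulr_ge0// expR_ge0.
apply: le_trans (abs_cont_L2_bound cf eL2 (sw M) w0 df x01) _.
apply: ler_pM => //; first exact: L2norm_ge0.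
under eq_Rintegral do rewrite exprMn.
have iE : leb.-integrable `[0, x] (EFin \o (fun t => expR (lam * t) ^+ 2)).
  have [_] := sw 1; rewrite (_ : (fun t => _) = (fun t => expR (lam * t) ^+ 2));
      last first.
    by apply/funext => t; rewrite mul1r.
  move=> i1; apply: (@integrableS _ _ _ leb I01 _
      (EFin \o (fun t => expR (lam * t) ^+ 2))
    (measurable_itv _) (measurable_itv _) _ i1).
  by apply: itv_sub01 => t; rewrite in_itv/= => /andP[-> tx]; case/andP: x01 => _;
      exact: le_trans.
rewrite RintegralZl//.
rewrite sqrtrM ?sqr_ge0// sqrtr_sqr ger0_norm// -mulrA ler_wpM2l//.
have l20 : 0 < 2 * lam by rewrite mulr_gt0.
apply: le_trans (ler_wsqrtr (Rintegral_expR_le lam0 x01)) _.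
by rewrite sqrtrM ?sqr_ge0// sqrtr_sqr ger0_norm ?expR_ge0// sqrtrV// ltW.
Qed.

Lemma abs_cont_affine_bound f e E (m a b : R) : abs_cont f -> inL2 e -> inL2 E ->
  L2norm e <= m -> 0 <= a -> 0 <= b ->
  {ae leb, forall x : R, x \in `[0, 1] ->
     exists2 l, cderive_at f x l & cmod l <= cmod (e x) * (a * cmod (E x) + b)} ->
  forall x : R, 0 <= x <= 1 -> cmod (f x - f 0) <= m * (a * L2norm E + b).
Proof.
move=> cf eL2 EL2 em a0 b0 df x x01.
have [mE _] := inL2_sq_integrable EL2.
have w0 t : 0 <= a * cmod (E t) + b by rewrite addr_ge0// mulr_ge0// cmod_ge0.
have sw : sq_integrable I01 (fun t => a * cmod (E t) + b).
  split; first by apply: measurable_funD => //; exact: measurable_funM.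
  have mI : measurable I01 by exact: measurable_itv.
  have s1 : sq_integrable I01 (fun=> b : R).
    by apply: sq_integrable_within => t; exact: cst_continuous.
  have [_ j1] := inL2_sq_integrable EL2; have [_ j3] := s1.
  have j2 := sq_integrableM mI (inL2_sq_integrable EL2) s1.
  have := integrableD_EFin mI (integrableD_EFin mI (integrableZ_EFin (a ^+ 2) mI j1)
     (integrableZ_EFin (2 * a) mI j2)) j3.
  congr (is_true (_.-integrable _ _)); congr (_ \o _); apply/funext => t; ring.
apply: le_trans (abs_cont_L2_bound cf eL2 sw w0 df x01) _.
apply: ler_pM => //; first exact: L2norm_ge0.
exact: sqrt_Rintegral_affine_le.
Qed.

(** A bound for |p| + |q| on [0,1] when p' = - e1 q, q' = - e2 p, p(0) = 1 and
    q(0) = 0, where m1 and m2 bound the L_2 norms of e1 and e2. *)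
Definition system_bound (m1 m2 : R) : R := 2 * expR (2 * (m1 + m2) ^+ 2 + 1).

Section System.
Variables (e1 e2 p q : R -> R[i]) (m1 m2 : R).
Hypotheses (e1L2 : inL2 e1) (e2L2 : inL2 e2).
Hypotheses (e1m : L2norm e1 <= m1) (e2m : L2norm e2 <= m2).
Hypotheses (acp : abs_cont p) (acq : abs_cont q) (p0 : p 0 = 1) (q0 : q 0 = 0).
Hypothesis dpq : {ae leb, forall x : R, x \in `[0, 1] ->
  cderive_at p x (- (e1 x * q x)) /\ cderive_at q x (- (e2 x * p x))}.

Let B := system_bound m1 m2.
Let E x := cint x e2.

Let B0 : 0 <= B. Proof. by rewrite mulr_ge0// expR_ge0. Qed.
Let m10 : 0 <= m1. Proof. exact: le_trans (L2norm_ge0 _) e1m. Qed.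
Let m20 : 0 <= m2. Proof. exact: le_trans (L2norm_ge0 _) e2m. Qed.

(** With lam large enough, the weighted maximum M of (|p| + |q|) exp(- lam x)
    satisfies M <= 1 + M / 2. *)
Lemma system_bounded x : 0 <= x <= 1 -> cmod (p x) + cmod (q x) <= B.
Proof.
(* the term 2 (m1 + m2)^2 yields (m1 + m2) / sqrt (2 lam) <= 1 / 2; the term 1
   makes lam positive when m1 = m2 = 0 *)
pose lam := 2 * (m1 + m2) ^+ 2 + 1.
have lam0 : 0 < lam by rewrite ltr_wpDl// mulr_ge0// sqr_ge0.
pose y t := cmod (p t * cexp (t%:C * (- lam)%:C)) + cmod
    (q t * cexp (t%:C * (- lam)%:C)).
have yE t : y t = (cmod (p t) + cmod (q t)) * expR (- (lam * t)).
  rewrite /y (cmodM (p t)) (cmodM (q t)) cmod_cexp -mulrDl; congr (_ * expR _).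
  by rewrite -rmorphM/= mulrN mulrC.
have cy : {within I01, continuous y}.
  have c1 := abs_cont_within (abs_contM acp (abs_cont_cexp (- lam)%:C)) (@cmod_distl R).
  have c2 := abs_cont_within (abs_contM acq (abs_cont_cexp (- lam)%:C)) (@cmod_distl R).
  by move=> t; exact: (cvgD (c1 t) (c2 t)).
have [c] := EVT_max (@ler01 R) cy; rewrite in_itv/= => c01 yM.
set M := y c in yM.
have M0 : 0 <= M by rewrite /M yE mulr_ge0 ?expR_ge0// addr_ge0 ?cmod_ge0.
have pqM t : 0 <= t <= 1 -> cmod (p t) + cmod (q t) <= M * expR (lam * t).
  move=> t01; have := yM t; rewrite in_itv/= => /(_ t01).
  by rewrite yE expRN ler_pdivrMr ?expR_gt0.
have s0 : 0 < Num.sqrt (2 * lam) by rewrite sqrtr_gt0 mulr_gt0.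
have hs : (m1 + m2) / Num.sqrt (2 * lam) <= 1 / 2.
  rewrite ler_pdivrMr// mul1r mulrC ler_pdivlMr//.
  have m120 : 0 <= (m1 + m2) * 2 by rewrite mulr_ge0// addr_ge0.
  rewrite -[leLHS]ger0_norm// -sqrtr_sqr; apply: ler_wsqrtr.
  by rewrite exprMn /lam; have := sqr_ge0 (m1 + m2); lra.
have hp : cmod (p c) <= 1 + m1 * (M * expR (lam * c) / Num.sqrt (2 * lam)).
  have := abs_cont_exp_bound acp e1L2 e1m M0 lam0 _ c01; rewrite p0 => H.
  rewrite -(subrK 1 (p c)) (le_trans (cmodD _ _))// cmod1 addrC lerD2l; apply: H.
  apply: (ae_imp dpq) => t dt t01; have [dp _] := dt t01; exists (- (e1 t * q t)) => //.
  rewrite cmodN cmodM ler_wpM2l ?cmod_ge0//; rewrite in_itv/= in t01.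
  by apply: le_trans (pqM t t01); rewrite lerDr cmod_ge0.
have hq : cmod (q c) <= m2 * (M * expR (lam * c) / Num.sqrt (2 * lam)).
  have := abs_cont_exp_bound acq e2L2 e2m M0 lam0 _ c01; rewrite q0 subr0; apply.
  apply: (ae_imp dpq) => t dt t01; have [_ dq] := dt t01; exists (- (e2 t * p t)) => //.
  rewrite cmodN cmodM ler_wpM2l ?cmod_ge0//; rewrite in_itv/= in t01.
  by apply: le_trans (pqM t t01); rewrite lerDl cmod_ge0.
have M2 : M <= 2.
  have h1 : cmod (p c) + cmod (q c) <= 1 + M * expR (lam * c) * (1 / 2).
    apply: le_trans (lerD hp hq) _; rewrite -addrA lerD2l -mulrDl.
    rewrite [leLHS]mulrCA; apply: ler_wpM2l => //.
    by rewrite mulr_ge0// expR_ge0.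
  have h2 : M * expR (lam * c) = cmod (p c) + cmod (q c).
    by rewrite /M yE expRN mulfVK// gt_eqF// expR_gt0.
  have h3 : 1 <= expR (lam * c).
    rewrite -expR0 ler_expR; apply: mulr_ge0; first exact: ltW.
    by case/andP: c01.
  rewrite -(ler_pM2r (expR_gt0 (lam * c))).
  by rewrite -h2 in h1; lra.
move=> x01; apply: le_trans (pqM x x01) _.
apply: ler_pM => //.
rewrite ler_expR -/lam; apply: ler_piMr; first exact: ltW.
by case/andP: x01.
Qed.

Let EL2 : inL2 E. Proof. exact/abs_cont_inL2/abs_cont_cint. Qed.
Let g := L2norm E.
Let g0 : 0 <= g. Proof. exact: L2norm_ge0. Qed.

(** The function q + E p has derivative - E e1 q, in which q is bounded. *)
Lemma system_q_bound x : 0 <= x <= 1 ->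
  cmod (q x) <= B * cmod (E x) + m1 * (B * g).
Proof.
move=> x01; pose f t := q t + E t * p t.
have acE : abs_cont E by exact: abs_cont_cint.
have acf : abs_cont f by apply: abs_contD => //; exact: abs_contM.
have f0 : f 0 = 0 by rewrite /f q0 /E cint0 mul0r addr0.
have df : {ae leb, forall x : R, x \in `[0, 1] ->
     exists2 l, cderive_at f x l & cmod l <= cmod (e1 x) * (B * cmod (E x) + 0)}.
  apply: (ae_imp2 dpq (ae_cderive_cint e2L2)) => t dt dE t01.
  have [dp dq] := dt t01; exists (- (E t * e1 t * q t)).
    have := cderiveD dq (cderiveM (dE t01) dp); congr cderive_at.
    by rewrite -/(E t); ring.
  rewrite cmodN !cmodM addr0 mulrAC mulrC ler_wpM2l ?cmod_ge0// mulrC.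
  rewrite ler_wpM2r ?cmod_ge0//; rewrite in_itv/= in t01.
  by apply: le_trans (system_bounded t01); rewrite lerDr cmod_ge0.
have := abs_cont_affine_bound acf e1L2 EL2 e1m B0 (lexx 0) df x01.
rewrite f0 subr0 addr0 -/g => H.
have -> : q x = f x - E x * p x by rewrite /f; ring.
apply: le_trans (cmodB _ _) _; rewrite addrC; apply: lerD => //.
rewrite cmodM mulrC ler_wpM2r ?cmod_ge0//.
by apply: le_trans (system_bounded x01); rewrite lerDl cmod_ge0.
Qed.

Lemma system_p_bound x : 0 <= x <= 1 ->
  cmod (p x - 1) <= m1 * (B * g + m1 * (B * g)).
Proof.
move=> x01; rewrite -p0.
apply: (abs_cont_affine_bound acp e1L2 EL2 e1m B0 _ _ x01).
  by rewrite !mulr_ge0.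
apply: (ae_imp dpq) => t dt t01; have [dp _] := dt t01; exists (- (e1 t * q t)) => //.
rewrite in_itv/= in t01.
by rewrite cmodN cmodM ler_wpM2l ?cmod_ge0// system_q_bound.
Qed.

(** The function q + E has derivative - e2 (p - 1). *)
Lemma system_qE_bound x : 0 <= x <= 1 ->
  cmod (q x + E x) <= m2 * (m1 * (B * g + m1 * (B * g))).
Proof.
move=> x01; pose f t := q t + E t.
have acf : abs_cont f by apply: abs_contD => //; exact: abs_cont_cint.
have f0 : f 0 = 0 by rewrite /f q0 /E cint0 addr0.
have K0 : 0 <= m1 * (B * g + m1 * (B * g)) by rewrite !(mulr_ge0, addr_ge0).
have df : {ae leb, forall x : R, x \in `[0, 1] -> exists2 l, cderive_at f x l &
     cmod l <= cmod (e2 x) * (0 * cmod (E x) + m1 * (B * g + m1 * (B * g)))}.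
  apply: (ae_imp2 dpq (ae_cderive_cint e2L2)) => t dt dE t01.
  have [_ dq] := dt t01; exists (- (e2 t * (p t - 1))).
    have := cderiveD dq (dE t01); congr cderive_at.
    by ring.
  rewrite mul0r add0r cmodN cmodM ler_wpM2l ?cmod_ge0//; rewrite in_itv/= in t01.
  exact: system_p_bound.
have := abs_cont_affine_bound acf e2L2 EL2 e2m (lexx 0) K0 df x01.
by rewrite f0 subr0 mul0r add0r.
Qed.

End System.
End SystemEstimates.

(** * The columns of the matrix equation *)

Section Columns.
Variable R : realType.
Local Notation leb := (@lebesgue_measure R).
Local Notation I01 := (`[(0 : R), (1 : R)]%classic : set R).
Implicit Types (f g s : R -> R[i]) (x d : R) (z w mu : R[i]).

Lemma cmod_cexp_scale w (c t : R) : `|complex.Re w| <= c -> 0 <= t <= 1 ->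
  cmod (cexp (t%:C * w)) <= expR c.
Proof.
move=> wc /andP[t0 t1]; rewrite cmod_cexp ler_expR cReM/= mul0r subr0.
apply: le_trans (ler_norm _) _; rewrite normrM ger0_norm//.
by apply: le_trans wc; rewrite ler_piMl.
Qed.

(** A bound for the L_2 norm of exp(2 w t) s(t) when |Re w| <= d and n bounds the
    L_2 norm of s. *)
Definition col_norm d (n : R) : R := expR (2 * d) * n.

(** The resulting bound for |p| + |q|. *)
Definition col_bound d (n : R) : R := system_bound (col_norm d n) (col_norm d n).

(** The constant common to the estimates of the entries of a column; the
    factor exp d bounds the exponentials that were factored out. *)
Definition col_const d (n : R) : R :=
  expR d * (col_bound d n * (1 + col_norm d n)).

Lemma col_norm_ge0 d n : 0 <= n -> 0 <= col_norm d n.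
Proof. by move=> n0; rewrite mulr_ge0// expR_ge0. Qed.

Lemma col_bound_ge0 d n : 0 <= col_bound d n.
Proof. by rewrite mulr_ge0// expR_ge0. Qed.

Lemma col_const_ge0 d n : 0 <= n -> 0 <= col_const d n.
Proof.
move=> n0; rewrite mulr_ge0 ?expR_ge0// mulr_ge0 ?col_bound_ge0//.
by rewrite addr_ge0// col_norm_ge0.
Qed.

(** One column of the matrix equation: f is its diagonal entry and g its
    off-diagonal one, and z is i mu for the first column, - i mu for the
    second. *)
Section Column.
Variables (d n : R) (z : R[i]) (s s' f g : R -> R[i]).
Hypotheses (zd : `|complex.Re z| <= d) (sL2 : inL2 s) (s'L2 : inL2 s').
Hypotheses (sn : L2norm s <= n) (s'n : L2norm s' <= n).
Hypotheses (acf : abs_cont f) (acg : abs_cont g) (f0 : f 0 = 1) (g0 : g 0 = 0).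
Hypothesis dfg : {ae leb, forall x : R, x \in `[0, 1] ->
  cderive_at f x (z * f x - s x * g x) /\ cderive_at g x (- (z * g x) - s' x * f x)}.

Let e1 t := cexp (t%:C * (- (2 * z))) * s t.
Let e2 t := cexp (t%:C * (2 * z)) * s' t.
Let p t := cexp (t%:C * - z) * f t.
Let q t := cexp (t%:C * z) * g t.
Let m := col_norm d n.

Let zd2 : `|complex.Re (2 * z)| <= 2 * d.
Proof.
have -> : complex.Re (2 * z) = 2 * complex.Re z.
  by case: (z) => a b /=; rewrite !mulr2n !mulrDl !mul1r; ring.
by rewrite normrM ger0_norm// ler_wpM2l.
Qed.

Let e1P : inL2 e1 /\ L2norm e1 <= m.
Proof.
have [||h1 h2] := @inL2_mul_bounded R s (fun t => cexp (t%:C * (- (2 * z))))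
    (expR (2 * d)) sL2 (abs_cont_cexp _).
- exact: expR_ge0.
- by move=> x x01; apply: cmod_cexp_scale => //; rewrite cReN normrN.
- by split=> //; apply: le_trans h2 _; rewrite ler_wpM2l ?expR_ge0.
Qed.

Let e2P : inL2 e2 /\ L2norm e2 <= m.
Proof.
have [||h1 h2] := @inL2_mul_bounded R s' (fun t => cexp (t%:C * (2 * z)))
    (expR (2 * d)) s'L2 (abs_cont_cexp _).
- exact: expR_ge0.
- by move=> x x01; apply: cmod_cexp_scale.
- by split=> //; apply: le_trans h2 _; rewrite ler_wpM2l ?expR_ge0.
Qed.

Let acp : abs_cont p. Proof. by apply: abs_contM => //; exact: abs_cont_cexp. Qed.
Let acq : abs_cont q. Proof. by apply: abs_contM => //; exact: abs_cont_cexp. Qed.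
Let p0 : p 0 = 1. Proof. by rewrite /p f0 rmorph0 mul0r cexp0 mulr1. Qed.
Let q0 : q 0 = 0. Proof. by rewrite /q g0 mulr0. Qed.

Let dpq : {ae leb, forall x : R, x \in `[0, 1] ->
  cderive_at p x (- (e1 x * q x)) /\ cderive_at q x (- (e2 x * p x))}.
Proof.
apply: (ae_imp dfg) => x H x01; have [df dg] := H x01; split.
  have := cderiveM (cderive_cexp (cderive_lin (- z) x)) df; congr cderive_at.
  have -> : e1 x * q x = cexp (x%:C * (- (2 * z))) * cexp (x%:C * z) * (s x * g x).
    by rewrite /e1 /q; ring.
  rewrite -cexpD (_ : x%:C * - (2 * z) + x%:C * z = x%:C * - z); last by ring.
  by ring.
have := cderiveM (cderive_cexp (cderive_lin z x)) dg; congr cderive_at.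
have -> : e2 x * p x = cexp (x%:C * (2 * z)) * cexp (x%:C * - z) * (s' x * f x).
  by rewrite /e2 /p; ring.
rewrite -cexpD (_ : x%:C * (2 * z) + x%:C * - z = x%:C * z); last by ring.
by ring.
Qed.

Let E x := cint x e2.
Let G := L2norm E.
Let B := col_bound d n.

Let fE x : f x - cexp (x%:C * z) = cexp (x%:C * z) * (p x - 1).
Proof.
by rewrite /p mulrBr mulrA -cexpD mulrN subrr cexp0 mul1r mulr1.
Qed.

Let gE x : g x = cexp (x%:C * - z) * q x.
Proof.
by rewrite /q mulrA -cexpD mulrN addNr cexp0 mul1r.
Qed.

Let cz x : 0 <= x <= 1 -> cmod (cexp (x%:C * z)) <= expR d.
Proof. exact: cmod_cexp_scale. Qed.
Let czN x : 0 <= x <= 1 -> cmod (cexp (x%:C * - z)) <= expR d.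
Proof. by apply: cmod_cexp_scale; rewrite cReN normrN. Qed.

Let m0 : 0 <= m.
Proof. by apply: col_norm_ge0; exact: le_trans (L2norm_ge0 _) sn. Qed.

Lemma column_diag_bounded x : 0 <= x <= 1 ->
  cmod (f x - cexp (x%:C * z)) <= expR d * (B + 1).
Proof.
move=> x01; rewrite fE cmodM; apply: ler_pM; rewrite ?cmod_ge0 ?cz//.
apply: le_trans (cmodB _ _) _; rewrite cmod1 lerD2r.
have [[h1 h2] [h3 h4]] := (e1P, e2P).
apply: le_trans (system_bounded h1 h3 h2 h4 acp acq p0 q0 dpq x01).
by rewrite lerDl cmod_ge0.
Qed.

Lemma column_off_bounded x : 0 <= x <= 1 -> cmod (g x) <= expR d * B.
Proof.
move=> x01; rewrite gE cmodM; apply: ler_pM; rewrite ?cmod_ge0 ?czN//.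
have [[h1 h2] [h3 h4]] := (e1P, e2P).
apply: le_trans (system_bounded h1 h3 h2 h4 acp acq p0 q0 dpq x01).
by rewrite lerDr cmod_ge0.
Qed.

Lemma column_diag_le x : 0 <= x <= 1 ->
  cmod (f x - cexp (x%:C * z)) <= m * col_const d n * G.
Proof.
move=> x01; rewrite fE cmodM.
have [[h1 h2] [h3 h4]] := (e1P, e2P).
have := system_p_bound h1 h3 h2 h4 acp acq p0 q0 dpq x01 => H.
apply: le_trans (ler_pM (cmod_ge0 _) (cmod_ge0 _) (cz x01) H) _.
rewrite /col_const -/m -/(col_bound d n) -/E -/G le_eqVlt; apply/orP; left; apply/eqP.
by ring.
Qed.

Lemma column_off_le x : 0 <= x <= 1 ->
  cmod (g x) <= col_const d n * (cmod (E x) + G).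
Proof.
move=> x01; rewrite gE cmodM.
have [[h1 h2] [h3 h4]] := (e1P, e2P).
have := system_q_bound h1 h3 h2 h4 acp acq p0 q0 dpq x01 => H.
apply: le_trans (ler_pM (cmod_ge0 _) (cmod_ge0 _) (czN x01) H) _.
rewrite /col_const -/m -/(col_bound d n) -/(E x) -/E -/G -mulrA ler_wpM2l ?expR_ge0//.
rewrite -subr_ge0.
rewrite (_ : _ - _ = col_bound d n * G + col_bound d n * m * cmod (E x)); last by ring.
have b0 := col_bound_ge0 d n.
apply: addr_ge0; apply: mulr_ge0.
- exact: b0.
- exact: L2norm_ge0.
- exact: mulr_ge0.
- exact: cmod_ge0.
Qed.

Lemma column_off_corrected_le x : 0 <= x <= 1 ->
  cmod (g x + cexp (x%:C * - z) * E x) <= m ^+ 2 * col_const d n * G.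
Proof.
move=> x01; rewrite gE -mulrDr cmodM.
have [[h1 h2] [h3 h4]] := (e1P, e2P).
have := system_qE_bound h1 h3 h2 h4 acp acq p0 q0 dpq x01 => H.
apply: le_trans (ler_pM (cmod_ge0 _) (cmod_ge0 _) (czN x01) H) _.
rewrite /col_const -/m -/(col_bound d n) -/E -/G le_eqVlt; apply/orP; left; apply/eqP.
by ring.
Qed.

End Column.
End Columns.

(** * The matrix equation *)

Section Matrices.
Variable R : realType.
Local Notation leb := (@lebesgue_measure R).
Local Notation I01 := (`[(0 : R), (1 : R)]%classic : set R).
Implicit Types (f g s : R -> R[i]) (x d : R) (z w mu : R[i]) (F : R -> 'M[R[i]]_2).

Lemma abs_cont_eq f g : (forall x, 0 <= x <= 1 -> f x = g x) -> abs_cont f -> abs_cont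
    g.
Proof.
move=> fg cf e e0; have [del del0 H] := cf e e0; exists del => // n u v uv tI sd.
rewrite (eq_bigr (fun i => cmod (f (v i) - f (u i)))); first exact: H.
move=> i _; have [u0 [u1 v1]] := uv i.
by rewrite !fg ?u0 ?v1 ?(le_trans u0 u1) ?(le_trans u1 v1).
Qed.

Lemma ord2P (P : 'I_2 -> Prop) : P 0 -> P 1 -> forall k, P k.
Proof.
move=> P0 P1 k; have [->//|->//] : k = 0 \/ k = 1.
by case: k => [[|[|//]] kP]; [left|right]; apply/val_inj.
Qed.

Lemma sum_ord2 (V : nmodType) (G : 'I_2 -> V) : \sum_k G k = G 0 + G 1.
Proof.
by rewrite !big_ord_recl big_ord0 addr0; congr (_ + G _); exact/val_inj.
Qed.

Lemma inMC_abs_cont F : (forall k j, abs_cont (fun x => F x k j)) -> inMC F.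
Proof.
by move=> H k j; split;
  [exact: (abs_cont_within_Re (H k j))|exact: (abs_cont_within_Im (H k j))].
Qed.

Lemma MCnorm_le F (c00 c01 c10 c11 c : R) :
  (forall x, 0 <= x <= 1 -> cmod (F x 0 0) <= c00) ->
  (forall x, 0 <= x <= 1 -> cmod (F x 0 1) <= c01) ->
  (forall x, 0 <= x <= 1 -> cmod (F x 1 0) <= c10) ->
  (forall x, 0 <= x <= 1 -> cmod (F x 1 1) <= c11) ->
  (c00 + c01) + (c10 + c11) <= c -> (MCnorm F <= c%:E)%E.
Proof.
move=> h00 h01 h10 h11 hc; rewrite /MCnorm !sum_ord2.
have key (k j : 'I_2) (b : R) : (forall x, 0 <= x <= 1 -> cmod (F x k j) <= b) ->
    (ereal_sup [set (cmod (F x k j))%:E | x in I01] <= b%:E)%E.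
  move=> H; apply: ge_ereal_sup => _ [x x01 <-]; rewrite lee_fin; apply: H.
  by move: x01; rewrite /= in_itv.
apply: (@le_trans _ _ ((c00 + c01) + (c10 + c11))%:E); last by rewrite lee_fin.
by rewrite !EFinD; apply: leeD; apply: leeD; exact: key.
Qed.

Lemma cintZ (c : R[i]) f x : inL2 f -> 0 <= x <= 1 ->
  cint x (fun t => c * f t) = c * cint x f.
Proof.
move=> fL2 /andP[x0 x1].
have mx : measurable (`[0, x]%classic : set R) by exact: measurable_itv.
have sub (h : R -> R) : leb.-integrable I01 (EFin \o h) ->
    leb.-integrable `[0, x] (EFin \o h).
  move=> ih; apply: (@integrableS _ _ _ leb I01 _ (EFin \o h)
    (measurable_itv _) mx _ ih).
  by apply: itv_sub01 => t; rewrite in_itv/= => /andP[-> tx]; exact: le_trans x1.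
have iR := sub _ (inL2_integrable_Re fL2).
have iI := sub _ (inL2_integrable_Im fL2).
have jR (r : R) := integrableZ_EFin r mx iR.
have jI (r : R) := integrableZ_EFin r mx iI.
apply: complex_ext; rewrite ?cReM ?cImM /cint/=.
  under eq_Rintegral do rewrite cReM.
  by rewrite RintegralB// RintegralZl// RintegralZl.
under eq_Rintegral do rewrite cImM.
by rewrite RintegralD// RintegralZl// RintegralZl.
Qed.

Lemma real_complex2M (t : R) : (2 * t)%:C = 2 * t%:C.
Proof. by rewrite !mulr_natl rmorphMn. Qed.

(** The number i mu, the upper diagonal entry of A_mu. *)
Definition iz mu : R[i] := (0 +i* 1) * mu.

Lemma Re_iz mu : complex.Re (iz mu) = - complex.Im mu.
Proof. by rewrite /iz cReM /=; ring. Qed.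

Lemma scale_Amx (c : R) mu :
  c%:C *: Amx mu = mx22 (c%:C * iz mu) 0 0 (c%:C * - iz mu).
Proof.
apply/matrixP => k j; rewrite !mxE -/(iz mu).
by case: ifP => _; case: ifP => _; ring.
Qed.

Lemma mexp_Amx (c : R) mu :
  mexp (c%:C *: Amx mu) = mx22 (cexp (c%:C * iz mu)) 0 0 (cexp (c%:C * - iz mu)).
Proof. by rewrite scale_Amx mexp_diag. Qed.

Lemma expint2E mu s x :
  expint 2 mu s x = cint x (fun t => cexp (t%:C * (2 * iz mu)) * s t).
Proof.
rewrite /expint; congr cint; apply/funext => t; congr (cexp _ * _).
by rewrite real_complex2M /iz; ring.
Qed.

Lemma expintN2E mu s x :
  expint (-2) mu s x = cint x (fun t => cexp (t%:C * (2 * - iz mu)) * s t).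
Proof.
rewrite /expint; congr cint; apply/funext => t; congr (cexp _ * _).
by rewrite mulNr rmorphN /= real_complex2M /iz; ring.
Qed.

Lemma inL2_cexp w s : inL2 s -> inL2 (fun t => cexp (t%:C * w) * s t).
Proof.
move=> sL2; have [] // := @inL2_mul_bounded R s (fun t => cexp (t%:C * w))
    (expR (cmod w)) sL2 (abs_cont_cexp _).
by move=> t t01; apply: cmod_cexp_scale => //; exact: normr_Re_le.
Qed.

Lemma D0E s1 s2 mu x : inL2 s1 -> inL2 s2 -> 0 <= x <= 1 ->
  D0 s1 s2 x mu = mx22 0 (- (cexp (x%:C * iz mu) * expint (-2) mu s1 x))
                       (- (cexp (x%:C * - iz mu) * expint 2 mu s2 x)) 0.
Proof.
move=> s1L2 s2L2 x01.
have c0 : cint x (fun=> 0 : R[i]) = 0.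
  by apply: complex_ext; rewrite /cint/= Rintegral_cst ?mul0r.
have phE w t : cexp ((x - 2 * t)%:C * w) = cexp (x%:C * w) * cexp (t%:C * (2 * - w)).
  by rewrite -cexpD rmorphB /= real_complex2M; congr cexp; ring.
rewrite expint2E expintN2E -(cintZ _ (inL2_cexp _ s1L2) x01)
    -(cintZ _ (inL2_cexp _ s2L2) x01).
apply/matrixP => k j; rewrite !mxE.
under [X in cint x X]eq_fun do
  rewrite mexp_Amx mx22_mul !(mul0r, mulr0, addr0, add0r) mxE.
case: ifP => _; case: ifP => _; rewrite ?c0 ?oppr0//; congr (- cint _ _);
  by apply/funext => t; rewrite phE ?opprK mulrA.
Qed.

(** The four scalar equations contained in the matrix equation. *)
Lemma solution_columns s1 s2 mu F : is_solution s1 s2 mu F ->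
  {ae leb, forall x : R, x \in `[0, 1] ->
  [/\ cderive_at (fun t => F t 0 0) x (iz mu * F x 0 0 - s1 x * F x 1 0),
      cderive_at (fun t => F t 1 0) x (- (iz mu * F x 1 0) - s2 x * F x 0 0),
      cderive_at (fun t => F t 1 1) x (- iz mu * F x 1 1 - s2 x * F x 0 1) &
      cderive_at (fun t => F t 0 1) x (- (- iz mu * F x 0 1) - s1 x * F x 1 1)]}.
Proof.
move=> [_ ae _]; apply: (ae_imp ae) => x H x01.
have [F' [dF eqF]] := H x01.
have eqF' k j : F' k j = (Amx mu *m F x - Jmx s1 s2 x *m F x) k j.
  by rewrite -eqF addrK.
have A1 : Amx mu = mx22 (iz mu) 0 0 (- iz mu).
  by have := scale_Amx 1 mu; rewrite rmorph1 scale1r !mul1r.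
split; move: (dF 0 0) (dF 1 0) (dF 1 1) (dF 0 1);
  rewrite !eqF' A1 !mxE !sum_ord2 !mxE /= => h1 h2 h3 h4.
- by move: h1; congr cderive_at; ring.
- by move: h2; congr cderive_at; ring.
- by move: h3; congr cderive_at; ring.
- by move: h4; congr cderive_at; ring.
Qed.

End Matrices.

Theorem corollary2p5 (R : realType) (d : R) (hd : 0 < d) :
  exists a0 a1 a2 : R -> R -> R,
  forall (s1 s2 : R -> R[i]) (hs1 : inL2 s1) (hs2 : inL2 s2)
    (D : R -> R[i] -> 'M[R[i]]_2)
    (hD : forall mu : R[i], is_solution s1 s2 mu (fun x => D x mu)),
  let n1 := L2norm s1 in
  let n2 := L2norm s2 in
  (exists Rem : R -> R[i] -> 'M[R[i]]_2,
    forall mu : R[i], strip d mu ->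
    [/\ forall x : R, x \in `[0, 1] ->
          D x mu = mexp (x%:C *: Amx mu) + Rem x mu,
        inMC (fun x => Rem x mu),
        (MCnorm (fun x => Rem x mu) <= (a0 n1 n2)%:E)%E
      & forall x : R, x \in `[0, 1] ->
          Mnorm (Rem x mu) <=
            a1 n1 n2 * (gamma s1 s2 mu + gamma0 s1 s2 x mu)]) /\
  (exists R0 : R -> R[i] -> 'M[R[i]]_2,
    forall mu : R[i], strip d mu ->
    [/\ forall x : R, x \in `[0, 1] ->
          D x mu = mexp (x%:C *: Amx mu) + D0 s1 s2 x mu + R0 x mu,
        inMC (fun x => R0 x mu)
      & (MCnorm (fun x => R0 x mu) <=
          (a2 n1 n2 * (gamma s1 s2 mu + gamma1 s1 s2 mu))%:E)%E]).
Proof.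
(* each constant bounds the sum of the estimates of the four entries, in which
   both L_2 norms are replaced by their sum *)
exists (fun n1 n2 => expR d * (4 * col_bound d (n1 + n2) + 2)).
exists (fun n1 n2 => (col_norm d (n1 + n2) + 1) * col_const d (n1 + n2)).
exists (fun n1 n2 => (col_norm d (n1 + n2) + col_norm d (n1 + n2) ^+ 2) *
                     col_const d (n1 + n2)).
move=> s1 s2 hs1 hs2 D hD n1 n2.
pose n := n1 + n2.
have n10 : 0 <= n1 by exact: L2norm_ge0.
have n20 : 0 <= n2 by exact: L2norm_ge0.
have n0 : 0 <= n by exact: addr_ge0.
have s1n : L2norm s1 <= n by rewrite lerDl.
have s2n : L2norm s2 <= n by rewrite lerDr.
have m0 : 0 <= col_norm d n by exact: col_norm_ge0.
have C0 : 0 <= col_const d n by exact: col_const_ge0.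
have izd mu : strip d mu -> `|complex.Re (iz mu)| <= d by rewrite Re_iz normrN.
have izNd mu : strip d mu -> `|complex.Re (- iz mu)| <= d by rewrite cReN Re_iz opprK.
(* M is the remainder after the exponential, and M - D_0 the second one *)
pose M x mu := D x mu - mx22 (cexp (x%:C * iz mu)) 0 0 (cexp (x%:C * - iz mu)).
have acD mu k j : abs_cont (fun x => D x mu k j) by have [] := hD mu.
have D00 mu : D 0 mu = 1%:M by have [] := hD mu.
have D0k mu k j : D 0 mu k j = (k == j)%:R by rewrite D00 mxE.
have eqs mu := solution_columns (hD mu).
have col1 mu : {ae @lebesgue_measure R, forall x : R, x \in `[0, 1] ->
  cderive_at (fun t => D t mu 0 0) x (iz mu * D x mu 0 0 - s1 x * D x mu 1 0) /\
  cderive_at (fun t => D t mu 1 0) x (- (iz mu * D x mu 1 0) - s2 x * D x mu 0 0)}.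
  by apply: (ae_imp (eqs mu)) => x H /H[].
have col2 mu : {ae @lebesgue_measure R, forall x : R, x \in `[0, 1] ->
  cderive_at (fun t => D t mu 1 1) x (- iz mu * D x mu 1 1 - s2 x * D x mu 0 1) /\
  cderive_at (fun t => D t mu 0 1) x (- (- iz mu * D x mu 0 1) - s1 x * D x mu 1 1)}.
  by apply: (ae_imp (eqs mu)) => x H /H[].
(* the L_2 norms of the primitives attached to the two columns *)
pose g1 mu := L2norm (expint 2 mu s2); pose g2 mu := L2norm (expint (-2) mu s1).
have g1E mu : g1 mu = L2norm (fun x => cint x
    (fun t => cexp (t%:C * (2 * iz mu)) * s2 t)).
  by congr L2norm; apply/funext => x; exact: expint2E.
have g2E mu : g2 mu = L2norm (fun x => cint x
    (fun t => cexp (t%:C * (2 * - iz mu)) * s1 t)).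
  by congr L2norm; apply/funext => x; exact: expintN2E.
have g10 mu : 0 <= g1 mu by exact: L2norm_ge0.
have g20 mu : 0 <= g2 mu by exact: L2norm_ge0.
have gamma_ge mu : g1 mu + g2 mu <= gamma s1 s2 mu.
  have := L2norm_ge0 (expint 2 mu s1); have := L2norm_ge0 (expint (-2) mu s2).
  by rewrite /gamma -/(g1 mu) -/(g2 mu); lra.
have acM mu k j : abs_cont (fun x => M x mu k j).
  rewrite (_ : (fun x => _) = fun x => D x mu k j +
     - mx22 (cexp (x%:C * iz mu)) 0 0 (cexp (x%:C * - iz mu)) k j); last first.
    by apply/funext => x; rewrite !mxE.
  apply: abs_contD => //; apply: abs_contN.
  rewrite (_ : (fun x => _) = fun x : R =>
     if k == 0 then if j == 0 then cexp (x%:C * iz mu) else 0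
     else if j == 0 then 0 else cexp (x%:C * - iz mu)); last first.
    by apply/funext => x; rewrite mxE.
  by case: (k == 0); case: (j == 0); first [exact: abs_cont_cexp|exact: abs_cont_cst].
have ME mu x : [/\ M x mu 0 0 = D x mu 0 0 - cexp (x%:C * iz mu),
   M x mu 0 1 = D x mu 0 1, M x mu 1 0 = D x mu 1 0 &
   M x mu 1 1 = D x mu 1 1 - cexp (x%:C * - iz mu)].
  by split; rewrite !mxE/= ?subr0.
split.
  exists M => mu hmu; have zd := izd mu hmu; have zNd := izNd mu hmu; split.
  - by move=> x _; rewrite mexp_Amx /M addrC subrK.
  - exact: inMC_abs_cont.
  - apply: (@MCnorm_le _ _ (expR d * (col_bound d n + 1)) (expR d * col_bound d n)
       (expR d * col_bound d n) (expR d * (col_bound d n + 1)))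
       => [x x01|x x01|x x01|x x01|].
    + have [-> _ _ _] := ME mu x.
      exact: (column_diag_bounded zd hs1 hs2 s1n s2n (acD mu 0 0) (acD mu 1 0)
        (D0k mu 0 0) (D0k mu 1 0) (col1 mu) x01).
    + have [_ -> _ _] := ME mu x.
      exact: (column_off_bounded zNd hs2 hs1 s2n s1n (acD mu 1 1) (acD mu 0 1)
        (D0k mu 1 1) (D0k mu 0 1) (col2 mu) x01).
    + have [_ _ -> _] := ME mu x.
      exact: (column_off_bounded zd hs1 hs2 s1n s2n (acD mu 0 0) (acD mu 1 0)
        (D0k mu 0 0) (D0k mu 1 0) (col1 mu) x01).
    + have [_ _ _ ->] := ME mu x.
      exact: (column_diag_bounded zNd hs2 hs1 s2n s1n (acD mu 1 1) (acD mu 0 1)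
        (D0k mu 1 1) (D0k mu 0 1) (col2 mu) x01).
    + by rewrite le_eqVlt; apply/orP; left; apply/eqP; rewrite -/n; ring.
  - move=> x; rewrite in_itv/= => x01.
    rewrite /Mnorm !sum_ord2; have [-> -> -> ->] := ME mu x.
    have h4 : cmod (D x mu 0 0 - cexp (x%:C * iz mu)) <=
        col_norm d n * col_const d n * g1 mu.
      by rewrite g1E;
        exact: (column_diag_le zd hs1 hs2 s1n s2n (acD mu 0 0) (acD mu 1 0)
          (D0k mu 0 0) (D0k mu 1 0) (col1 mu) x01).
    have h3 : cmod (D x mu 1 0) <= col_const d n * (cmod (expint 2 mu s2 x) + g1 mu).
      by rewrite g1E expint2E;
        exact: (column_off_le zd hs1 hs2 s1n s2n (acD mu 0 0) (acD mu 1 0)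
          (D0k mu 0 0) (D0k mu 1 0) (col1 mu) x01).
    have h2 : cmod (D x mu 1 1 - cexp (x%:C * - iz mu)) <=
        col_norm d n * col_const d n * g2 mu.
      by rewrite g2E;
        exact: (column_diag_le zNd hs2 hs1 s2n s1n (acD mu 1 1) (acD mu 0 1)
          (D0k mu 1 1) (D0k mu 0 1) (col2 mu) x01).
    have h1 : cmod (D x mu 0 1) <= col_const d n * (cmod (expint (-2) mu s1 x) + g2 mu).
      by rewrite g2E expintN2E;
        exact: (column_off_le zNd hs2 hs1 s2n s1n (acD mu 1 1) (acD mu 0 1)
          (D0k mu 1 1) (D0k mu 0 1) (col2 mu) x01).
    rewrite -/n.
    have hg : (g1 mu + g2 mu) +
        (cmod (expint 2 mu s2 x) + cmod (expint (-2) mu s1 x)) <=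
        gamma s1 s2 mu + gamma0 s1 s2 x mu.
      apply: lerD => //; rewrite /gamma0.
      have := cmod_ge0 (expint 2 mu s1 x); have := cmod_ge0 (expint (-2) mu s2 x).
      by lra.
    apply: le_trans (ler_wpM2l _ hg); last by rewrite mulr_ge0// addr_ge0.
    have := cmod_ge0 (expint 2 mu s2 x); have := cmod_ge0 (expint (-2) mu s1 x).
    move: (cmod (expint 2 mu s2 x)) (cmod (expint (-2) mu s1 x)) h1 h2 h3 h4.
    move=> u v h1 h2 h3 h4 v0 u0.
    have h5 : 0 <= col_norm d n * col_const d n * (u + v).
      by rewrite !mulr_ge0// addr_ge0.
    by lra.
exists (fun x mu => M x mu - D0 s1 s2 x mu) => mu hmu.
have zd := izd mu hmu; have zNd := izNd mu hmu.
have e2 x := D0E mu hs1 hs2 (x := x).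
have R0E x : 0 <= x <= 1 -> [/\
   (M x mu - D0 s1 s2 x mu) 0 0 = D x mu 0 0 - cexp (x%:C * iz mu),
   (M x mu - D0 s1 s2 x mu) 0 1 =
     D x mu 0 1 + cexp (x%:C * iz mu) * expint (-2) mu s1 x,
   (M x mu - D0 s1 s2 x mu) 1 0 =
     D x mu 1 0 + cexp (x%:C * - iz mu) * expint 2 mu s2 x &
   (M x mu - D0 s1 s2 x mu) 1 1 = D x mu 1 1 - cexp (x%:C * - iz mu)].
  by move=> x01; rewrite e2//; split; rewrite !mxE/= ?subr0 ?opprK.
have acE1 : abs_cont (fun x => expint 2 mu s2 x).
  rewrite (_ : (fun x => _) = (fun x => cint x
      (fun t => cexp (t%:C * (2 * iz mu)) * s2 t))).
    by apply: abs_cont_cint; exact: inL2_cexp.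
  by apply/funext => x; exact: expint2E.
have acE2 : abs_cont (fun x => expint (-2) mu s1 x).
  rewrite (_ : (fun x => _) = (fun x => cint x
      (fun t => cexp (t%:C * (2 * - iz mu)) * s1 t))).
    by apply: abs_cont_cint; exact: inL2_cexp.
  by apply/funext => x; exact: expintN2E.
split.
- by move=> x _; rewrite mexp_Amx /M -addrA subrKC addrC subrK.
- apply: inMC_abs_cont; apply: ord2P; apply: ord2P.
  + apply: (abs_cont_eq (f := fun x => D x mu 0 0 + - cexp (x%:C * iz mu))).
      by move=> x /R0E[-> _ _ _].
    by apply: abs_contD => //; apply: abs_contN; exact: abs_cont_cexp.
  + apply: (abs_cont_eq (f := fun x =>
      D x mu 0 1 + cexp (x%:C * iz mu) * expint (-2) mu s1 x)).
      by move=> x /R0E[_ -> _ _].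
    by apply: abs_contD => //; apply: abs_contM => //; exact: abs_cont_cexp.
  + apply: (abs_cont_eq (f := fun x =>
      D x mu 1 0 + cexp (x%:C * - iz mu) * expint 2 mu s2 x)).
      by move=> x /R0E[_ _ -> _].
    by apply: abs_contD => //; apply: abs_contM => //; exact: abs_cont_cexp.
  + apply: (abs_cont_eq (f := fun x => D x mu 1 1 + - cexp (x%:C * - iz mu))).
      by move=> x /R0E[_ _ _ ->].
    by apply: abs_contD => //; apply: abs_contN; exact: abs_cont_cexp.
- have gamma10 : 0 <= gamma1 s1 s2 mu.
    apply: Rintegral_ge0 => x _; apply: mulr_ge0; last exact: sqr_ge0.
    by rewrite addr_ge0// cmod_ge0.
  have hg : g1 mu + g2 mu <= gamma s1 s2 mu + gamma1 s1 s2 mu.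
    by apply: le_trans (gamma_ge mu) _; rewrite lerDl.
  apply: (@MCnorm_le _ _ (col_norm d n * col_const d n * g1 mu)
     (col_norm d n ^+ 2 * col_const d n * g2 mu)
     (col_norm d n ^+ 2 * col_const d n * g1 mu)
     (col_norm d n * col_const d n * g2 mu)) => [x x01|x x01|x x01|x x01|].
  + have [-> _ _ _] := R0E x x01; rewrite g1E.
    exact: (column_diag_le zd hs1 hs2 s1n s2n (acD mu 0 0) (acD mu 1 0)
      (D0k mu 0 0) (D0k mu 1 0) (col1 mu) x01).
  + have [_ -> _ _] := R0E x x01; rewrite g2E expintN2E.
    have := column_off_corrected_le zNd hs2 hs1 s2n s1n (acD mu 1 1) (acD mu 0 1)
      (D0k mu 1 1) (D0k mu 0 1) (col2 mu) x01.
    by rewrite opprK.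
  + have [_ _ -> _] := R0E x x01; rewrite g1E expint2E.
    exact: (column_off_corrected_le zd hs1 hs2 s1n s2n (acD mu 0 0) (acD mu 1 0)
      (D0k mu 0 0) (D0k mu 1 0) (col1 mu) x01).
  + have [_ _ _ ->] := R0E x x01; rewrite g2E.
    exact: (column_diag_le zNd hs2 hs1 s2n s1n (acD mu 1 1) (acD mu 0 1)
      (D0k mu 1 1) (D0k mu 0 1) (col2 mu) x01).
  + rewrite -/n; apply: le_trans (ler_wpM2l _ hg).
      by rewrite le_eqVlt; apply/orP; left; apply/eqP; ring.
    by rewrite mulr_ge0// addr_ge0// sqr_ge0.
Qed.
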